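(* Let $\Omega\subset\mathbb{R}^n$ be a bounded domain, $s\in(0,1)$, and $F\in C^1(\mathbb{R})$. Let $u:\mathbb{R}^n\to\mathbb{R}$ in $C(\Omega)$ be a one-sided minimizer by above of the functional $$\mathcal{E}_{s,F}(w)=\frac{c_{n,s}}4\iint_{Q(\Omega)}\frac{|w(x)-w(y)|^2}{|x-y|^{n+2s}}\,dx\,dy-\int_\Omega F(w(x))\,dx$$ in $\Omega$. Then $u$ is a viscosity supersolution of $(-\Delta)^sv=F'(v)$ in $\Omega$.
   Context: Notation: $\Omega^c=\mathbb{R}^n\setminus\Omega$, $Q(\Omega)=(\mathbb{R}^n\times\mathbb{R}^n)\setminus(\Omega^c\times\Omega^c)$; $(-\Delta)^su(x)=c_{n,s}\,\mathrm{P.V.}\int_{\mathbb{R}^n}\frac{u(x)-u(y)}{|x-y|^{n+2s}}\,dy$ with $c_{n,s}>0$ a normalizing constant. $L^1_s(\mathbb{R}^n)=\{u\in L^1_{\rm loc}(\mathbb{R}^n):\int_{\mathbb{R}^n}\frac{|u(y)|}{1+|y|^{n+2s}}\,dy<+\infty\}$. One-sided minimizer by above: $\mathcal{E}_{s,F}(u)<\infty$ and, for all functions $v$ such that $v\ge u$ in $\Omega$ and $v=u$ in $\Omega^c$, $\mathcal{E}_{s,F}(v)\ge\mathcal{E}_{s,F}(u)$. Viscosity supersolution: $u\in C(\Omega)\cap L^1_s(\mathbb{R}^n)$ is a viscosity supersolution of $(-\Delta)^sv=F'(v)$ in $\Omega$ if, whenever $x_0\in\Omega$, $N$ is a neighborhood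 of $x_0$ in $\Omega$, $\varphi$ is a $C^2$ function in $\overline N$, $\varphi(x_0)=u(x_0)$, and $\varphi(x)<u(x)$ for every $x\in N\setminus\{x_0\}$, the function $\overline\varphi$ defined by $\overline\varphi=\varphi$ in $N$ and $\overline\varphi=u$ in $\mathbb{R}^n\setminus N$ satisfies $(-\Delta)^s\overline\varphi(x_0)\ge F'(\overline\varphi(x_0))$.
   Formalization: The energy of u is required to be finite, not merely less than plus infinity; if the integral of F(u) is plus infinity the energy is minus infinity, minimality says nothing, and the claim fails. *)

(* Defs.v *)
From HB Require Import structures.
From mathcomp Require Import all_boot all_order all_algebra.
From mathcomp Require Import all_classical all_reals all_analysis measurable_realfun.
From mathcomp Require Import lra.

Set Implicit Arguments.
Unset Strict Implicit.
Unset Printing Implicit Defensive.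

Import Order.TTheory GRing.Theory Num.Theory.
Import numFieldNormedType.Exports.

Local Open Scope classical_set_scope.
Local Open Scope ring_scope.

(* Euclidean spaces are the types 'rV[R]_n.+1, so that the dimension is n.+1.
   The library has no Lebesgue measure on them: lebesgue_outer is the Lebesgue
   outer measure (countable covers by closed boxes), lebesgue_space is 'rV[R]_n.+1
   with the sigma-algebra of its Caratheodory-measurable (i.e., Lebesgue) sets,
   and lebesgue_rV is the Lebesgue measure. *)
Definition box (R : realType) (n : nat) (p : 'rV[R]_n.+1 * 'rV[R]_n.+1) :
    set 'rV[R]_n.+1 :=
  [set x | forall i, p.1 0 i <= x 0 i <= p.2 0 i].

(* The box is empty when some p.1 0 i > p.2 0 i, hence the truncation at 0. *)
Definition box_volume (R : realType) (n : nat)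
    (p : 'rV[R]_n.+1 * 'rV[R]_n.+1) : R :=
  \prod_(i < n.+1) Num.max 0 (p.2 0 i - p.1 0 i).

Definition lebesgue_outer (R : realType) (n : nat) (X : set 'rV[R]_n.+1) :
    \bar R :=
  ereal_inf [set (\sum_(0 <= k <oo) (box_volume (B k))%:E)%E |
    B in [set B : nat -> 'rV[R]_n.+1 * 'rV[R]_n.+1 |
          X `<=` \bigcup_k box (B k)]].

Section lebesgue_outer_theory.
Variables (R : realType) (n : nat).
Implicit Types (X Y : set 'rV[R]_n.+1) (p : 'rV[R]_n.+1 * 'rV[R]_n.+1).
Local Open Scope ereal_scope.

Lemma box_volume_ge0 p : (0 <= box_volume p)%R.
Proof. by apply: prodr_ge0 => i _; rewrite le_max lexx. Qed.

Lemma lebesgue_outer_ge0 X : 0 <= lebesgue_outer X.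
Proof.
apply: le_ereal_inf_tmp => _ [B _ <-]; apply: nneseries_ge0 => k _ _.
by rewrite lee_fin box_volume_ge0.
Qed.

Lemma lebesgue_outer0 : lebesgue_outer (set0 : set 'rV[R]_n.+1) = 0.
Proof.
apply/eqP; rewrite eq_le lebesgue_outer_ge0 andbT.
apply: ereal_inf_lbound; exists (fun=> (0%R, 0%R)) => //=.
apply: eseries0 => k _ _; congr (_%:E).
by rewrite /box_volume big_ord_recl /= subrr maxxx mul0r.
Qed.

Lemma le_lebesgue_outer :
  {homo (@lebesgue_outer R n) : X Y / X `<=` Y >-> X <= Y}.
Proof.
move=> X Y XY; apply: ereal_inf_le_tmp => _ [B YB <-].
by exists B => //; exact: subset_trans YB.
Qed.

Lemma lebesgue_outer_cover X (e : R) : (0 < e)%R -> lebesgue_outer X < +oo ->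
  exists2 B : nat -> 'rV[R]_n.+1 * 'rV[R]_n.+1, X `<=` \bigcup_k box (B k) &
    \sum_(0 <= k <oo) (box_volume (B k))%:E <= lebesgue_outer X + e%:E.
Proof.
move=> e0 Xoo; have Xfin : lebesgue_outer X \is a fin_num.
  by rewrite ge0_fin_numE// lebesgue_outer_ge0.
have [_ [B XB <-] Be] := lb_ereal_inf_adherent e0 Xfin.
by exists B => //; exact: ltW.
Qed.

Lemma lebesgue_outer_sigma_subadditive :
  sigma_subadditive (@lebesgue_outer R n).
Proof.
move=> A; have [[i ioo]|] := pselect (exists i, lebesgue_outer (A i) = +oo).
  rewrite (eseries_pinfty _ _ ioo) ?leey// => k _.
  by rewrite -ltNye (lt_le_trans _ (lebesgue_outer_ge0 _)).
rewrite -forallNE => Aoo.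
suff add2e (e : {posnum R}) : lebesgue_outer (\bigcup_k A k) <=
    \sum_(0 <= i <oo) lebesgue_outer (A i) + e%:num%:E.
  by apply/lee_addgt0Pr => _/posnumP[].
rewrite (le_trans _ (epsilon_trick _ _ _))//; last first.
  by move=> k; exact: lebesgue_outer_ge0.
pose P k (B : nat -> 'rV[R]_n.+1 * 'rV[R]_n.+1) := A k `<=` \bigcup_j box (B j) /\
  \sum_(0 <= j <oo) (box_volume (B j))%:E <=
    lebesgue_outer (A k) + (e%:num / (2 ^ k.+1)%:R)%:E.
have [G PG] : {G : nat -> nat -> 'rV[R]_n.+1 * 'rV[R]_n.+1 &
    forall k, P k (G k)}.
  apply: (@choice _ _ P) => k.
  have [||B AB Be] := @lebesgue_outer_cover (A k) (e%:num / (2 ^ k.+1)%:R).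
  - by rewrite divr_gt0// ltr0n expn_gt0.
  - by rewrite ltey; apply/eqP; exact: Aoo.
  - by exists B.
pose f (ij : nat * nat) := (box_volume (G ij.1 ij.2))%:E.
have f0 ij : 0 <= f ij by rewrite lee_fin box_volume_ge0.
apply: (@le_trans _ _ (\esum_(ij in setT) f ij)).
  have /card_esym/ppcard_eqP[g] := card_nat2.
  apply: ereal_inf_lbound; exists (fun k => G (g k).1 (g k).2) => /=.
    move=> x [i _ /(PG i).1[j _ xij]]; exists (g^-1%FUN (i, j)) => //=.
    by rewrite invK ?inE.
  rewrite nneseries_esumT; last by move=> k; rewrite lee_fin box_volume_ge0.
  by rewrite (@reindex_esum _ _ _ setT setT g).
rewrite -[leLHS](_ : \esum_(i in setT) \esum_(j in setT) f (i, j) = _).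
  rewrite -nneseries_esumT; last by move=> i; apply: esum_ge0.
  apply: lee_nneseries => [i _ _|i _].
    by apply: esum_ge0.
  rewrite -nneseries_esumT//; exact: (PG i).2.
rewrite (@esum_esum _ _ _ setT (fun=> setT) (fun i j => f (i, j)))//.
rewrite (_ : setT `*`` _ = setT); last by apply/seteqP; split.
by apply: eq_esum => -[].
Qed.

End lebesgue_outer_theory.

HB.instance Definition _ (R : realType) (n : nat) :=
  isOuterMeasure.Build R 'rV[R]_n.+1 (@lebesgue_outer R n)
    (@lebesgue_outer0 R n) (@lebesgue_outer_ge0 R n)
    (@le_lebesgue_outer R n) (@lebesgue_outer_sigma_subadditive R n).


Notation lebesgue_space R n := (caratheodory_type (@lebesgue_outer R n)).

Lemma max0_cut (R : realType) (a b c : R) :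
  Num.max 0 (Num.min b c - a) + Num.max 0 (b - Num.max a c) =
  Num.max 0 (b - a).
Proof. by case: (leP b c); case: (leP a c); rewrite /Order.max; do !case: ifP; lra. Qed.

Section lebesgue_rV.
Variables (R : realType) (n : nat).
Local Open Scope ereal_scope.

Definition lebesgue_rV : set (lebesgue_space R n) -> \bar R :=
  @lebesgue_outer R n.

HB.instance Definition _ := isMeasure.Build _ _ _ lebesgue_rV
  (caratheodory_measure0 _) (@caratheodory_measure_ge0 _ _ _)
  (@caratheodory_measure_sigma_additive _ _ _).

Implicit Types (p : 'rV[R]_n.+1 * 'rV[R]_n.+1).

Lemma box_volume_cut (i : 'I_n.+1) (c : R) p :
  exists p1 p2, [/\ box p `&` [set x | x 0 i <= c]%R `<=` box p1,
    box p `&` [set x | c <= x 0 i]%R `<=` box p2 &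
    (box_volume p1 + box_volume p2 = box_volume p)%R].
Proof.
exists (p.1, \row_j if j == i then Num.min (p.2 0 j) c else p.2 0 j)%R.
exists (\row_j (if j == i then Num.max (p.1 0 j) c else p.1 0 j), p.2)%R.
split.
- move=> x [px xc] j; rewrite /= !mxE; have /andP[-> xj] := px j.
  by case: eqP => [->|//]; rewrite le_min xc andbT; have /andP[] := px i.
- move=> x [px xc] j; rewrite /= !mxE; have /andP[xj ->] := px j.
  rewrite andbT; case: eqP => [->|//]; rewrite ge_max xc andbT.
  by have /andP[] := px i.
- rewrite /box_volume (bigD1 i)//= [X in (_ + X = _)%R](bigD1 i)//=.
  rewrite [RHS](bigD1 i)//= !mxE eqxx.
  rewrite (eq_bigr (fun j => Num.max 0 (p.2 0 j - p.1 0 j))%R); last first.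
    by move=> j /negbTE ji; rewrite mxE ji.
  rewrite [X in (_ + _ * X)%R](eq_bigr
      (fun j => Num.max 0 (p.2 0 j - p.1 0 j))%R); last first.
    by move=> j /negbTE ji; rewrite mxE ji.
  rewrite -mulrDl; congr (_ * _)%R.
  exact: max0_cut.
Qed.

Lemma measurable_halfspace (i : 'I_n.+1) (c : R) (H : set (lebesgue_space R n)) :
  H `<=` [set x : 'rV[R]_n.+1 | x 0 i <= c]%R ->
  ~` H `<=` [set x : 'rV[R]_n.+1 | c <= x 0 i]%R -> measurable H.
Proof.
move=> Hc cH; apply: le_caratheodory_measurable => X.
have [Xoo|] := ltP (lebesgue_outer X) +oo; last first.
  by rewrite leye_eq => /eqP Xoo; rewrite [leRHS]Xoo leey.
apply/lee_addgt0Pr => e e0.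
have [B XB Be] := lebesgue_outer_cover e0 Xoo.
apply: le_trans Be.
have /choice[f1 /choice[f2 f12]] := fun k => box_volume_cut i c (B k).
rewrite (eq_eseriesr (g := fun k =>
    (box_volume (f1 k))%:E + (box_volume (f2 k))%:E)); last first.
  by move=> k _; rewrite -EFinD; have [_ _ ->] := f12 k.
rewrite nneseriesD; last 2 first.
- by move=> k _ _; rewrite lee_fin box_volume_ge0.
- by move=> k _ _; rewrite lee_fin box_volume_ge0.
apply: leeD; apply: ereal_inf_lbound.
- exists f1 => //= x [Xx Hx]; have [k _ Bkx] := XB _ Xx.
  by exists k => //; have [+ _ _] := f12 k; apply; split=> //; exact: Hc.
- exists f2 => //= x [Xx Hx]; have [k _ Bkx] := XB _ Xx.
  by exists k => //; have [_ + _] := f12 k; apply; split=> //; exact: cH.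
Qed.

Lemma measurable_box p : measurable (box p : set (lebesgue_space R n)).
Proof.
rewrite (_ : box p = \bigcap_(i in [set: 'I_n.+1])
    ([set x : 'rV[R]_n.+1 | x 0 i <= p.2 0 i]%R `&`
     ~` [set x : 'rV[R]_n.+1 | x 0 i < p.1 0 i]%R)); last first.
  apply/seteqP; split=> [x px i _|x px i].
    by have /andP[? ?] := px i; split => //=; apply/negP; rewrite -leNgt.
  by have [xi /negP] := px i Logic.I; rewrite -leNgt => ->.
apply: fin_bigcap_measurable => // i _; apply: measurableI.
  by apply: (@measurable_halfspace i (p.2 0 i)%R) => //= x /negP;
    rewrite -ltNge => /ltW.
apply: measurableC; apply: (@measurable_halfspace i (p.1 0 i)%R) => /= x.
  by move=> /ltW.
by move=> /negP; rewrite -leNgt.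
Qed.

Lemma lebesgue_rV_sigma_finite : sigma_finite setT lebesgue_rV.
Proof.
exists (fun k => box (const_mx (- k%:R), const_mx k%:R)%R).
  apply/esym/seteqP; split => // x _.
  have [k xk] : exists k : nat, (`|x| <= k%:R)%R.
    by exists (Num.truncn `|x|).+1; apply/ltW/truncnS_gt.
  exists k => // i; rewrite /= !mxE -ler_norml; apply: le_trans xk.
  rewrite [leRHS]mx_normrE.
  exact: (le_bigmax _ (fun ij => `|x ij.1 ij.2|) (0, i))%R.
move=> k; split; first exact: measurable_box.
pose p : 'rV[R]_n.+1 * 'rV[R]_n.+1 := (const_mx (- k%:R), const_mx k%:R)%R.
apply: (@le_lt_trans _ _ (box_volume p)%:E); last by rewrite ltry.
apply: ereal_inf_lbound.
exists (fun j => if j == 0%N then p else (0, 0)%R) => /=.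
  by move=> x px; exists 0%N.
rewrite (nneseries_split 0 1)//; last first.
  by move=> j _; rewrite lee_fin box_volume_ge0.
rewrite big_nat1 eseries0 ?adde0// => -[//|j] _ _ /=; congr (_%:E).
by rewrite /box_volume big_ord_recl /= subrr maxxx mul0r.
Qed.

HB.instance Definition _ := Measure_isSigmaFinite.Build _ _ _ lebesgue_rV
  lebesgue_rV_sigma_finite.

End lebesgue_rV.
Arguments lebesgue_rV {R n}.

Section nonlocal.
Variables (R : realType) (n : nat).
Notation Rn := 'rV[R]_n.+1.
Notation Leb := (lebesgue_space R n).
Notation leb := (@lebesgue_rV R n).
Implicit Types (Omega U N : set Rn) (u v w phi : Rn -> R) (x y : Rn).

(* The library norm `|x| on row vectors is the sup norm. *)
Definition enorm x : R := Num.sqrt (\sum_i x 0 i ^+ 2).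

(* |x| ^ (d + 2 s), where d = n.+1 is the dimension. *)
Definition kernel_power (s : R) x : R := enorm x `^ (n.+1%:R + 2 * s).

Definition C1_on U phi := forall i : 'I_n.+1,
  (forall x, U x -> derivable phi x (delta_mx 0 i)) /\
  {within U, continuous ('D_(delta_mx 0 i) phi)}.

Definition C2_on U phi :=
  C1_on U phi /\ forall i : 'I_n.+1, C1_on U ('D_(delta_mx 0 i) phi).

(* C^2 in a closed set means C^2 in an open set containing it. *)
Definition C2_closure N phi :=
  exists U, [/\ open U, closure N `<=` U & C2_on U phi].

Definition Qset Omega : set (Leb * Leb) := ~` (~` Omega `*` ~` Omega).

Definition interaction (s : R) Omega w : \bar R :=
  (\int[leb \x leb]_(z in Qset Omega)
    (`|w z.1 - w z.2| ^+ 2 / kernel_power s ((z.1 : Rn) - (z.2 : Rn)))%:E)%E.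

Definition potential (F : R -> R) Omega w : \bar R :=
  (\int[leb]_(x in Omega) (F (w x))%:E)%E.

Definition energy (c s : R) (F : R -> R) Omega w : \bar R :=
  ((c / 4)%:E * interaction s Omega w - potential F Omega w)%E.

(* The library totalizes +oo - +oo. The energy of w is meaningful in [-oo, +oo]
   when w is Lebesgue measurable, the integral of F \o w exists in the extended
   sense, and the difference defining the energy is not of the form oo - oo. *)
Definition energy_defined (c s : R) (F : R -> R) Omega w : Prop :=
  [/\ measurable_fun [set: Leb] w,
      ((\int[leb]_(x in Omega) (fun y => (F (w y))%:E)^\+ x) +?
       - (\int[leb]_(x in Omega) (fun y => (F (w y))%:E)^\- x))%E &
      ((c / 4)%:E * interaction s Omega w +? - potential F Omega w)%E].

(* Finite energy excludes the value -oo, at which the inequality holds for every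
   competitor; then F \o u is integrable on Omega. *)
Definition minimizer_by_above (c s : R) (F : R -> R) Omega u : Prop :=
  [/\ energy_defined c s F Omega u,
      energy c s F Omega u \is a fin_num &
      forall v, energy_defined c s F Omega v ->
        (forall x, Omega x -> u x <= v x) ->
        (forall x, ~ Omega x -> v x = u x) ->
        (energy c s F Omega u <= energy c s F Omega v)%E].

Definition L1_loc u : Prop :=
  forall K : set Rn, compact K -> leb.-integrable K (fun x => (u x)%:E).

Definition L1_s (s : R) u : Prop :=
  L1_loc u /\
  (\int[leb]_y (`|u y| / (1 + kernel_power s y))%:E < +oo)%E.

Definition truncated_fraclap (c s : R) v x (eps : R) : R :=
  c * \int[leb]_(y in [set y : Leb | eps <= enorm (x - (y : Rn))])
        ((v x - v y) / kernel_power s (x - (y : Rn))).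

(* The principal value exists: the truncated integrals converge absolutely and
   have a finite limit. *)
Definition fraclap_defined (c s : R) v x : Prop :=
  (forall eps : R, 0 < eps ->
     leb.-integrable [set y : Leb | eps <= enorm (x - (y : Rn))]
       (fun y => ((v x - v y) / kernel_power s (x - (y : Rn)))%:E)) /\
  cvg (truncated_fraclap c s v x eps @[eps --> 0^'+]).

Definition fraclap (c s : R) v x : R :=
  lim (truncated_fraclap c s v x eps @[eps --> 0^'+]).

(* patch u N phi is phi on N and u elsewhere. As fraclap is a total function, the
   existence of the principal value is part of the requirement. *)
Definition viscosity_supersolution (c s : R) (F : R -> R) Omega u : Prop :=
  [/\ {within Omega, continuous u}, L1_s s u &
      forall (x0 : Rn) N phi, Omega x0 -> nbhs x0 N -> N `<=` Omega ->
        measurable (N : set Leb) -> C2_closure N phi ->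
        phi x0 = u x0 -> (forall x, N x -> x != x0 -> phi x < u x) ->
        fraclap_defined c s (patch u N phi) x0 /\
        (F^`())%classic (patch u N phi x0) <= fraclap c s (patch u N phi) x0].

End nonlocal.

(* Main.v *)
Require Import Defs.
From mathcomp Require Import all_boot all_order all_algebra.
From mathcomp Require Import all_classical all_reals all_analysis measurable_realfun.
From mathcomp Require Import ring lra.
Import Order.TTheory GRing.Theory Num.Theory.
Import numFieldNormedType.Exports.
Local Open Scope classical_set_scope.
Local Open Scope ring_scope.
Set Implicit Arguments.
Unset Strict Implicit.
Unset Printing Implicit Defensive.

(** The proof is by contradiction, with the competitor obtained by lifting the
    test function.

    Write d for the dimension, p = d + 2 s, and K(h) = |h|^-p. Finiteness of the
    energy gives the integrability of u against (1 + |y|^p)^-1: by Tonelli, for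
    some x in Omega the integral over y of |u x - u y|^2 K(x - y) is finite
    (lemma weighted_L1_of_interaction). Let phi touch u from below at x0 in N and
    let g be phi in N and u elsewhere. Symmetrizing the integral under the point
    reflection y |-> 2 x - y replaces g x - g y by a second symmetric difference,
    of size |x - y|^2 since phi is C^2; hence cutting the singularity off at
    distance a changes the operator by O(a^(2 - 2 s)), uniformly for x near x0,
    while the operator with a continuous cut-off is continuous in x at x0 by
    dominated convergence. Consequently the principal value exists at x0
    (cvg_cut_fraclap_sharp), and near x0 the truncated operators do not exceed it
    by more than a small error (cut_fraclap_sharp_usc).

    Suppose now that the fractional Laplacian of g at x0 is less than F'(u x0).
    Put Phi = g + delta 1_B for a small ball B around x0 and a much smaller
    delta, w = max(0, Phi - u) and v = u + w = max(u, Phi). Since phi < u away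
    from x0, w vanishes outside a smaller cube. The pointwise inequality
      |v x - v y|^2 <= |u x - u y|^2 + 2 (w x - w y) (Phi x - Phi y)
    (gagliardo_max_le), multiplied by K and integrated over |x - y| >= eps, turns
    by Fubini into
      I_eps(v) <= I(u) + 4 (integral of w times the truncated operator of Phi),
    and eps -> 0 gives the same bound for I(v) (interaction_competitor_le); in
    particular v has finite interaction energy. On the support of w, c times the
    truncated operator of Phi is at most F'(u x0) - 2 eta, while
    F(v) - F(u) >= (F'(u x0) - eta) w. Hence the energy of v is less than that of
    u by at least eta times the integral of w, which is positive; this
    contradicts minimality (energy_decrease).

    The measure is the Caratheodory restriction of an outer measure. The proof
    needs that its sigma-algebra contains the open sets (measurable_open), that
    it gives each box its volume (leb_box), and that it is invariant under point
    reflections (integral_point_refl). Integrals of powers of |x - y| are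
    estimated on dyadic cubes (integral_tail, integral_near). *)

(** * The Euclidean norm and the kernel *)

Section norms.
Variables (R : realType) (n : nat).
Notation Rn := 'rV[R]_n.+1.
Implicit Types (x y : Rn).

Lemma enorm_ge0 x : 0 <= enorm x.
Proof. exact: sqrtr_ge0. Qed.

Lemma enormN x : enorm (- x) = enorm x.
Proof.
by rewrite /enorm; congr Num.sqrt; apply: eq_bigr => i _; rewrite mxE sqrrN.
Qed.

Lemma coord_le_norm x i : `|x 0 i| <= `|x|.
Proof.
rewrite [leRHS]mx_normrE.
exact: (le_bigmax _ (fun ij => `|x ij.1 ij.2|) (0, i)).
Qed.

Lemma norm_leP x (r : R) : 0 <= r -> (forall i, `|x 0 i| <= r) -> `|x| <= r.
Proof.
move=> r0 xr; rewrite [leLHS]mx_normrE; apply: bigmax_le => // -[i j] _ /=.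
by rewrite ord1.
Qed.

Lemma norm_le_enorm x : `|x| <= enorm x.
Proof.
apply: norm_leP; first exact: enorm_ge0.
move=> i; rewrite -sqrtr_sqr; apply: ler_wsqrtr.
by rewrite (bigD1 i)//= lerDl sumr_ge0// => j _; exact: sqr_ge0.
Qed.

Lemma enorm_le_norm x : enorm x <= n.+1%:R * `|x|.
Proof.
rewrite -[leRHS]ger0_norm ?mulr_ge0// -sqrtr_sqr; apply: ler_wsqrtr.
apply: (@le_trans _ _ (\sum_(i < n.+1) `|x| ^+ 2)).
  by apply: ler_sum => i _; rewrite -real_normK ?num_real// lerXn2r ?nnegrE// coord_le_norm.
rewrite sumr_const card_ord exprMn -[leLHS]mulr_natl ler_wpM2r ?sqr_ge0//.
by rewrite -natrX ler_nat leq_pmull.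
Qed.

Lemma enorm0 : enorm (0 : Rn) = 0.
Proof.
apply/le_anti; rewrite enorm_ge0 andbT.
by apply: le_trans (enorm_le_norm 0) _; rewrite normr0 mulr0.
Qed.

Lemma enorm_gt0 x : (0 < enorm x) = (x != 0).
Proof.
apply/idP/idP; first by apply: contraTneq => ->; rewrite enorm0 ltxx.
by rewrite -normr_gt0 => /lt_le_trans; apply; exact: norm_le_enorm.
Qed.

Lemma continuous_coord i : continuous (fun x : Rn => x 0 i).
Proof.
exact: coord_continuous.
Qed.

Lemma continuous_enorm : continuous (@enorm R n).
Proof.
move=> x; rewrite /enorm.
apply: (@continuous_comp _ _ _ (fun y : Rn => \sum_i y 0 i ^+ 2) Num.sqrt); last first.
  exact: sqrt_continuous.
have fx : Filter (nbhs x) by exact: nbhs_filter.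
apply: (@cvg_big _ _ _ _ _ _ _ (nbhs x)) => [|i _]; first exact: add_continuous.
under eq_fun do rewrite expr2.
rewrite expr2.
by apply: (@cvgM _ _ (nbhs x)); exact: continuous_coord.
Qed.

End norms.

Section kernel.
Variables (R : realType) (n : nat) (s : R).
Hypothesis s_gt0 : 0 < s.
Notation Rn := 'rV[R]_n.+1.
Notation p := (n.+1%:R + 2 * s).
Implicit Types (x y : Rn).

(** The kernel |x|^-(d + 2 s); its value at 0 is 0, since inversion is total. *)
Definition rker x : R := (kernel_power s x)^-1.

Lemma exponent_gt0 : 0 < p.
Proof. by rewrite addr_gt0// mulr_gt0. Qed.

Lemma kernel_power_ge0 x : 0 <= kernel_power s x.
Proof. exact: powR_ge0. Qed.

Lemma kernel_power_gt0 x : x != 0 -> 0 < kernel_power s x.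
Proof. by rewrite -enorm_gt0 => ?; exact: powR_gt0. Qed.

Lemma kernel_powerN x : kernel_power s (- x) = kernel_power s x.
Proof. by rewrite /kernel_power enormN. Qed.

Lemma kernel_power0 : kernel_power s (0 : Rn) = 0.
Proof. by rewrite /kernel_power enorm0 powR0// gt_eqF// exponent_gt0. Qed.

(** Linear comparison of norms passes to the p-th powers. *)
Lemma kernel_power_le x y (A : R) : 0 <= A -> enorm x <= A * enorm y ->
  kernel_power s x <= A `^ p * kernel_power s y.
Proof.
move=> A0 xy; rewrite /kernel_power -powRM ?enorm_ge0//.
by apply: ge0_ler_powR; rewrite ?nnegrE ?mulr_ge0 ?enorm_ge0 ?(ltW exponent_gt0).
Qed.

Lemma rker_ge0 x : 0 <= rker x.
Proof. by rewrite invr_ge0 kernel_power_ge0. Qed.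

Lemma rkerN x : rker (- x) = rker x.
Proof. by rewrite /rker kernel_powerN. Qed.

Lemma rker0 : rker 0 = 0.
Proof. by rewrite /rker kernel_power0 invr0. Qed.

Lemma rker_powR x : rker x = enorm x `^ (- p).
Proof. by rewrite /rker powRN. Qed.

Lemma rker_le x (r : R) : 0 < r -> r <= enorm x -> rker x <= r `^ (- p).
Proof.
move=> r0 rx; rewrite powRN lef_pV2 ?posrE ?powR_gt0//; last exact: lt_le_trans rx.
by apply: ge0_ler_powR; rewrite ?nnegrE ?(ltW r0) ?enorm_ge0 ?(ltW exponent_gt0).
Qed.

(** The weight (1 + |x|^(d + 2 s))^-1 in the definition of L^1_s. *)
Definition wgt x : R := (1 + kernel_power s x)^-1.

Lemma wgt_gt0 x : 0 < wgt x.
Proof. by rewrite invr_gt0 ltr_pwDl// kernel_power_ge0. Qed.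

Lemma wgt_le1 x : wgt x <= 1.
Proof. by rewrite invf_le1 ?ltr_pwDl ?lerDl ?kernel_power_ge0. Qed.

(** Away from the singularity, the kernel is comparable to the weight, uniformly for
    the pole x in a bounded set; the next lemma is the converse bound. *)
Lemma rker_le_wgt (rho r : R) : 0 <= rho -> 0 < r ->
  exists2 C, 0 <= C & forall x y, `|x| <= rho -> r <= enorm (x - y) ->
    rker (x - y) <= C * wgt y.
Proof.
move=> rho0 r0; set A := n.+1%:R * (rho / r + 1).
have A0 : 0 <= A by rewrite mulr_ge0// addr_ge0// divr_ge0// ltW.
exists (A `^ p + r `^ (- p)); first by rewrite addr_ge0// powR_ge0.
move=> x y xrho rxy.
have xy0 : x - y != 0 by rewrite -enorm_gt0 (lt_le_trans r0).
rewrite ler_pdivlMr; last by rewrite ltr_pwDl// kernel_power_ge0.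
rewrite mulrDr mulr1 [leRHS]addrC lerD ?rker_le// /rker.
rewrite mulrC ler_pdivrMr ?kernel_power_gt0//.
apply: kernel_power_le => //.
apply: le_trans (enorm_le_norm _) _; rewrite /A -mulrA ler_wpM2l//.
have yxy : `|y| <= `|x| + `|x - y| by apply: le_trans (ler_normB _ _); rewrite opprB addrC subrK.
apply: le_trans yxy _; rewrite mulrDl mul1r lerD ?norm_le_enorm//.
apply: le_trans xrho _; rewrite mulrAC ler_pdivlMr//.
by rewrite ler_wpM2l.
Qed.

Lemma wgt_le_rker (rho : R) : 0 <= rho ->
  exists2 C, 0 <= C & forall x y, `|x| <= rho -> x != y ->
    wgt y <= C * rker (x - y).
Proof.
move=> rho0; set A := n.+1%:R * (rho + 1).
exists ((A `^ p + A `^ p)); first by rewrite addr_ge0// powR_ge0.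
move=> x y xrho xy.
have xy0 : x - y != 0 by rewrite subr_eq0.
rewrite ler_pdivlMr ?kernel_power_gt0// mulrC ler_pdivrMr; last first.
  by rewrite ltr_pwDl// kernel_power_ge0.
have A0 : 0 <= A by rewrite mulr_ge0// addr_ge0.
have xyE : enorm (x - y) <= n.+1%:R * (rho + enorm y).
  apply: le_trans (enorm_le_norm _) _; rewrite ler_wpM2l//.
  by apply: le_trans (ler_normB _ _) _; rewrite lerD// norm_le_enorm.
have [y1|y1] := leP (enorm y) 1.
  apply: (@le_trans _ _ (A `^ p)).
    apply: ge0_ler_powR; rewrite ?nnegrE ?enorm_ge0 ?(ltW exponent_gt0)//.
    by apply: le_trans xyE _; rewrite ler_wpM2l// lerD.
  rewrite [leRHS]mulrDl ler_wpDr ?mulr_ge0 ?addr_ge0 ?powR_ge0//.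
  by rewrite ler_peMr ?powR_ge0// lerDl powR_ge0.
apply: (@le_trans _ _ (A `^ p * kernel_power s y)).
  apply: kernel_power_le => //; apply: le_trans xyE _; rewrite /A -mulrA ler_wpM2l//.
  by rewrite mulrDl mul1r lerD// ler_peMr// ltW.
by rewrite [leRHS]mulrDl ler_wpDr ?mulr_ge0 ?addr_ge0 ?powR_ge0// ler_wpM2l ?powR_ge0// lerDr.
Qed.

End kernel.

(** * Measurability for the Lebesgue sigma-algebra *)

Section measurability.
Variables (R : realType) (n : nat).
Notation Rn := 'rV[R]_n.+1.
Notation Leb := (lebesgue_space R n).
Notation leb := (@lebesgue_rV R n).

Lemma measurable_coord i : measurable_fun [set: Leb] (fun x : Leb => (x : Rn) 0 i).
Proof.
apply: (@measurability _ _ _ _ setT _ _ (RGenOInfty.measurableE R)).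
move=> _ [_ [a ->] <-]; rewrite setTI.
rewrite -[X in measurable X]setCK; apply: measurableC.
apply: (@measurable_halfspace _ _ i a) => x /=.
  by rewrite in_itv/= andbT => /negP; rewrite -leNgt.
by move=> /contrapT; rewrite in_itv/= andbT => /ltW.
Qed.

Lemma measurable_enormB d (T : measurableType d) (f g : T -> Rn) :
  (forall i, measurable_fun setT (fun t => f t 0 i)) ->
  (forall i, measurable_fun setT (fun t => g t 0 i)) ->
  measurable_fun setT (fun t => enorm (f t - g t)).
Proof.
move=> mf mg.
rewrite (_ : (fun _ => _) = fun t => (\sum_i (f t 0 i - g t 0 i) ^+ 2) `^ 2^-1).
  apply: (measurableT_comp (measurable_powR _)).
  apply: measurable_sum => i; apply: measurable_funX.
  exact: measurable_funB.
apply/funext => t; rewrite /enorm -powR12_sqrt ?sumr_ge0// => [|i _]; last exact: sqr_ge0.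
by congr powR; apply: eq_bigr => i _; rewrite !mxE.
Qed.

Lemma measurable_enorm_l (x : Rn) :
  measurable_fun [set: Leb] (fun y : Leb => enorm (x - (y : Rn))).
Proof.
apply: (measurable_enormB (f := fun=> x) (g := fun y : Leb => (y : Rn))) => i.
  exact: measurable_cst.
exact: measurable_coord.
Qed.

Lemma measurable_rker_l s (x : Rn) :
  measurable_fun [set: Leb] (fun y : Leb => rker s (x - (y : Rn))).
Proof.
rewrite (_ : (fun _ => _) = fun y : Leb =>
    enorm (x - (y : Rn)) `^ (- (n.+1%:R + 2 * s))); last first.
  by apply/funext => y; rewrite rker_powR.
apply: (measurableT_comp (measurable_powR _)).
exact: measurable_enorm_l.
Qed.

Lemma measurable_enorm_prod :
  measurable_fun [set: Leb * Leb] (fun z : Leb * Leb => enorm ((z.1 : Rn) - (z.2 : Rn))).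
Proof.
apply: (measurable_enormB (f := fun z : Leb * Leb => (z.1 : Rn))
  (g := fun z : Leb * Leb => (z.2 : Rn))) => i.
  exact: (measurableT_comp (measurable_coord i)).
exact: (measurableT_comp (measurable_coord i)).
Qed.

Lemma measurable_rker_prod s :
  measurable_fun [set: Leb * Leb] (fun z : Leb * Leb => rker s ((z.1 : Rn) - (z.2 : Rn))).
Proof.
rewrite (_ : (fun _ => _) = fun z : Leb * Leb =>
    enorm ((z.1 : Rn) - (z.2 : Rn)) `^ (- (n.+1%:R + 2 * s))); last first.
  by apply/funext => y; rewrite rker_powR.
apply: (measurableT_comp (measurable_powR _)).
exact: measurable_enorm_prod.
Qed.

Lemma measurable_wgt s : measurable_fun [set: Leb] (wgt s : Leb -> R).
Proof.
pose k (y : Leb) := enorm (0 - (y : Rn)) `^ (n.+1%:R + 2 * s).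
rewrite (_ : (wgt s : Leb -> R) = fun y : Leb => (1 + k y) `^ (-1)); last first.
  apply/funext => y; have k0 : 0 <= 1 + k y by apply: addr_ge0 => //; exact: powR_ge0.
  by rewrite (powR_inv1 k0) /wgt /k sub0r enormN.
apply: (measurableT_comp (measurable_powR _)).
apply: (measurable_funD (measurable_cst _)).
exact: (measurableT_comp (measurable_powR _) (measurable_enorm_l _)).
Qed.

(** An open set is the union of the boxes with rational corners that it contains. *)
Lemma measurable_open (U : set Rn) : open U -> measurable (U : set Leb).
Proof.
move=> oU.
pose B (q : 'rV[rat]_n.+1 * 'rV[rat]_n.+1) : set Leb :=
  box (map_mx ratr q.1, map_mx ratr q.2).
pose F q : set Leb := if `[< B q `<=` U >] then B q else set0.
have -> : U = \bigcup_q F q.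
  apply/seteqP; split=> [x Ux|x [q _]]; last first.
    by rewrite /F; case: asboolP => // /[apply].
  have /nbhs_ballP[e/= e0 eU] : nbhs x U by exact: open_nbhs_nbhs.
  have /choice[a aP] i : exists q : rat, x 0 i - e / 2 < ratr q < x 0 i.
    have [|q] := @rat_in_itvoo R (x 0 i - e/2) (x 0 i).
      by rewrite ltrBlDr ltrDl divr_gt0.
    by rewrite in_itv/=; exists q.
  have /choice[b bP] i : exists q : rat, x 0 i < ratr q < x 0 i + e / 2.
    have [|q] := @rat_in_itvoo R (x 0 i) (x 0 i + e/2).
      by rewrite ltrDl divr_gt0.
    by rewrite in_itv/=; exists q.
  exists (\row_i a i, \row_i b i) => //; rewrite /F.
  have -> : `[< B (\row_i a i, \row_i b i) `<=` U >].
    apply/asboolP => y By; apply: eU; rewrite -ball_normE /ball_/=.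
    rewrite (@le_lt_trans _ _ (e / 2))//; last by rewrite ltr_pdivrMr// ltr_pMr// ltr1n.
    apply: norm_leP; first by rewrite divr_ge0// ltW.
    move=> i; have := By i; rewrite /= !mxE => /andP[ay yb].
    by have /andP[? ?] := aP i; have /andP[? ?] := bP i; rewrite ler_norml; lra.
  move=> i; rewrite /= !mxE; have /andP[_ /ltW->] := aP i.
  by have /andP[/ltW-> _] := bP i.
apply: countable_bigcupT_measurable.
  exact: countableP.
by move=> q; rewrite /F; case: asboolP => // _; exact: measurable_box.
Qed.

Lemma measurable_closed (U : set Rn) : closed U -> measurable (U : set Leb).
Proof.
by move=> cU; rewrite -[U]setCK; apply/measurableC/measurable_open/closed_openC.
Qed.

Lemma measurable_continuous_in (U : set Rn) (f : Rn -> R) : open U ->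
  (forall x, U x -> {for x, continuous f}) ->
  measurable_fun (U : set Leb) (f : Leb -> R).
Proof.
move=> oU cf.
apply: (@measurability _ _ Leb _ U f _ (RGenOpens.measurableE R)).
move=> _ [_ [a [b ->]] <-].
apply: measurable_open; rewrite openE => x [Ux fx].
have : nbhs x U by exact: open_nbhs_nbhs.
have : nbhs (f x) `]a, b[%classic by apply: open_nbhs_nbhs; split.
move=> /cf => /(_ Ux) h1 h2; rewrite /interior; near=> y; split.
  by near: y.
by near: y.
Unshelve. all: by end_near. Qed.

End measurability.

(** * The measure of boxes, and positivity on open sets *)

Lemma measurable_nneseries d (T : measurableType d) (R : realType) (D : set T)
    (h : nat -> T -> \bar R) :
  (forall k x, D x -> (0 <= h k x)%E) -> (forall k, measurable_fun D (h k)) ->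
  measurable_fun D (fun x => \sum_(0 <= k <oo) h k x)%E.
Proof.
move=> h0 mh.
apply: (@ge0_emeasurable_sum _ _ _ D h xpredT) => [k x Dx _|k _].
  exact: h0.
exact: mh.
Qed.

Section box_measure.
Variables (R : realType) (n : nat).
Notation Rn := 'rV[R]_n.+1.
Notation Leb := (lebesgue_space R n).
Notation leb := (@lebesgue_rV R n).
Implicit Types (p : Rn * Rn).

(* The proof that a countable cover of a box has at least the volume of the box
   integrates the inequality between indicator functions one coordinate at a time,
   with the Lebesgue measure of the line; no compactness is needed. *)
Let side p (i : 'I_n.+1) : R := Num.max 0 (p.2 0 i - p.1 0 i).
Let slice p (i : 'I_n.+1) (t : R) : R := \1_`[p.1 0 i, p.2 0 i] t.
(* The indicator function of the box with its first j coordinates integrated out. *)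
Let part p (j : nat) (x : Rn) : R :=
  \prod_(i < n.+1) (if (i < j)%N then side p i else slice p i (x 0 i)).

Let slice_ge0 p i t : 0 <= slice p i t. Proof. by rewrite /slice indicE. Qed.

Let side_ge0 p i : 0 <= side p i. Proof. by rewrite /side le_max lexx. Qed.

Let integral_slice p i (a : R) : 0 <= a ->
  (\int[lebesgue_measure]_t (a * slice p i t)%:E = (a * side p i)%:E)%E.
Proof.
move=> a0; under eq_integral do rewrite EFinM.
rewrite ge0_integralZl_EFin//=; last 2 first.
  by move=> t _; rewrite lee_fin slice_ge0.
  by apply/measurable_EFinP; exact: measurable_indic.
rewrite integral_indic// setIT [X in (_ * X)%E]lebesgue_measure_itv/= EFinM /side lte_fin.
by case: ltP => [ab|ba]; rewrite -?EFinB; congr (_ * _%:E)%E;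
  rewrite /Order.max; case: ltP => //; lra.
Qed.

Let part_cover p (B : nat -> Rn * Rn) (j : nat) : (j <= n.+1)%N ->
  box p `<=` \bigcup_k box (B k) ->
  forall x, ((part p j x)%:E <= \sum_(0 <= k <oo) (part (B k) j x)%:E)%E.
Proof.
move=> + pB; elim: j => [_ x|j IH jn x].
  have part0 q : part q 0 x = \1_(box q) x.
    rewrite /part indicE; have [xq|xq] := boolP (x \in box q).
      rewrite big1// => i _; rewrite /slice indicE mem_set//=.
      by rewrite in_itv/=; move/set_mem: xq; exact.
    apply/eqP; rewrite prodf_seq_eq0/=; apply/hasP.
    have /existsP[i iq] : [exists i, ~~ (q.1 0 i <= x 0 i <= q.2 0 i)].
      rewrite -negb_forall; apply: contra xq => /forallP xq.
      exact/mem_set.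
    exists i; first exact: mem_index_enum.
    by rewrite /slice indicE memNset//= in_itv/=; exact/negP.
  rewrite part0 indicE; have [xp|] := boolP (x \in box p); last first.
    by move=> _; apply: nneseries_ge0 => k _ _; rewrite lee_fin prodr_ge0.
  have [k _ xk] := pB _ (set_mem xp).
  rewrite (nneseriesD1 (n := k))//=; last first.
    by move=> m _; rewrite lee_fin prodr_ge0.
  rewrite {1}part0 indicE mem_set// leeDl// nneseries_ge0// => m _ _.
  by rewrite lee_fin prodr_ge0.
pose i0 := Ordinal jn.
pose rest q := \prod_(i < n.+1 | i != i0) (if (i < j)%N then side q i else slice q i (x 0 i)).
have rest_ge0 q : 0 <= rest q.
  by apply: prodr_ge0 => i _; case: ifP => _; [exact: side_ge0|exact: slice_ge0].
have partS q : part q j.+1 x = rest q * side q i0.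
  rewrite /part (bigD1 i0)//= ltnSn mulrC; congr (_ * _).
  apply: eq_bigr => i ii0; rewrite ltnS leq_eqVlt.
  by rewrite (_ : (nat_of_ord i == j) = false)//; apply/negbTE; exact: ii0.
(* The induction hypothesis is integrated over the coordinate i0. *)
pose y t : Rn := \row_i (if i == i0 then t else x 0 i).
have partt q t : part q j (y t) = rest q * slice q i0 t.
  rewrite /part (bigD1 i0)//= ltnn mxE eqxx mulrC; congr (_ * _).
  by apply: eq_bigr => i /negbTE ii0; rewrite mxE ii0.
have mslice q : measurable_fun [set: R] (fun t => (rest q * slice q i0 t)%:E).
  apply/measurable_EFinP; apply: measurable_funM => //.
  exact: measurable_indic.
have slice0 q t : (0 <= (rest q * slice q i0 t)%:E)%E.
  by rewrite lee_fin mulr_ge0.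
have : (\int[lebesgue_measure]_t (rest p * slice p i0 t)%:E <=
    \int[lebesgue_measure]_t
       \sum_(0 <= k <oo) (rest (B k) * slice (B k) i0 t)%:E)%E.
  apply: ge0_le_integral => //.
  - exact: mslice.
  - exact: (@measurable_nneseries _ _ R setT (fun k t => (rest (B k) * slice (B k) i0 t)%:E)).
  - move=> t _; have := IH (ltnW jn) (y t).
    by rewrite partt; under eq_eseriesr do rewrite partt.
rewrite integral_slice// integral_nneseries//; last by move=> k; exact: mslice.
rewrite partS => /le_trans; apply.
rewrite le_eqVlt; apply/orP; left; apply/eqP.
by apply: eq_eseriesr => k _; rewrite integral_slice// partS.
Qed.

Lemma leb_box p : leb (box p) = (box_volume p)%:E.
Proof.
apply/eqP; rewrite eq_le; apply/andP; split.
  apply: ereal_inf_lbound.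
  exists (fun j => if j == 0%N then p else (0, 0)) => /=.
    by move=> x px; exists 0%N.
  rewrite (nneseries_split 0 1)//; last first.
    by move=> j _; rewrite lee_fin box_volume_ge0.
  rewrite big_nat1 eseries0 ?adde0// => -[//|j] _ _ /=; congr (_%:E).
  by rewrite /box_volume big_ord_recl /= subrr maxxx mul0r.
apply: le_ereal_inf_tmp => _ [B pB <-].
have := part_cover (leqnn _) pB 0.
have partn q : part q n.+1 0 = box_volume q.
  by apply: eq_bigr => i _; rewrite ltn_ord.
by rewrite partn; under eq_eseriesr do rewrite partn.
Qed.

(** The closed cube of center x and side 2 r, i.e., a closed ball of the sup norm. *)
Definition cube (x : Rn) (r : R) : set Rn := [set y | `|x - y| <= r].

Lemma cubeE x r : 0 <= r -> cube x r = box (x - const_mx r, x + const_mx r).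
Proof.
move=> r0; apply/seteqP; split=> y /=.
  move=> xy i; rewrite !mxE.
  have := le_trans (coord_le_norm (x - y) i) xy.
  by rewrite !mxE ler_norml => /andP[? ?]; apply/andP; split; lra.
move=> xy; apply: norm_leP => // i; have := xy i.
by rewrite !mxE ler_norml => /andP[? ?]; apply/andP; split; lra.
Qed.

Lemma measurable_cube x r : 0 <= r -> measurable (cube x r : set Leb).
Proof. by move=> r0; rewrite cubeE//; exact: measurable_box. Qed.

Lemma leb_cube x r : 0 <= r -> leb (cube x r) = ((2 * r) ^+ n.+1)%:E.
Proof.
move=> r0; rewrite cubeE// leb_box; congr (_%:E).
rewrite /box_volume (eq_bigr (fun=> 2 * r)) ?prodr_const ?card_ord// => i _.
rewrite !mxE (_ : x 0 i + r - (x 0 i - r) = 2 * r); last by lra.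
by rewrite /Order.max; case: ltP => //; lra.
Qed.

Lemma leb_open_gt0 (U : set Rn) : open U -> U !=set0 -> (0 < leb U)%E.
Proof.
move=> oU [x Ux].
have /nbhs_ballP[e/= e0 eU] : nbhs x U by exact: open_nbhs_nbhs.
apply: (@lt_le_trans _ _ (leb (cube x (e / 2)))).
  by rewrite leb_cube ?divr_ge0 ?ltW// lte_fin exprn_gt0// mulr_gt0// divr_gt0.
apply: le_measure; rewrite ?inE.
- by apply: measurable_cube; rewrite divr_ge0// ltW.
- exact: measurable_open.
- move=> y xy; apply: eU; rewrite -ball_normE /ball_/=.
  by rewrite (le_lt_trans xy)// ltr_pdivrMr// ltr_pMr// ltr1n.
Qed.

End box_measure.

(** * Invariance under point reflections *)

Section reflection.
Variables (R : realType) (n : nat).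
Notation Rn := 'rV[R]_n.+1.
Notation Leb := (lebesgue_space R n).
Notation leb := (@lebesgue_rV R n).

(** The reflection y |-> z - y, whose fixed point is z / 2. *)
Definition point_refl (z : Rn) (y : Leb) : Leb := z - (y : Rn).

Lemma point_reflK z : involutive (point_refl z).
Proof. by move=> y; rewrite /point_refl opprB addrC subrK. Qed.

Lemma preimage_point_reflK z X : point_refl z @^-1` (point_refl z @^-1` X) = X.
Proof. by apply/seteqP; split=> y /=; rewrite point_reflK. Qed.

Let outer_refl_le z X : (lebesgue_outer (point_refl z @^-1` X) <= lebesgue_outer X)%E.
Proof.
apply: le_ereal_inf_tmp => _ [B XB <-]; apply: ereal_inf_lbound.
exists (fun k => (z - (B k).2, z - (B k).1)) => /=.
  move=> y /XB[k _ Bk]; exists k => // i; have := Bk i.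
  by rewrite /point_refl !mxE/= => /andP[? ?]; apply/andP; split; lra.
apply: eq_eseriesr => k _; congr (_%:E); apply: eq_bigr => i _ /=.
by rewrite !mxE; congr (Num.max _ _); lra.
Qed.

Lemma lebesgue_outer_point_refl z X : lebesgue_outer (point_refl z @^-1` X) = lebesgue_outer X.
Proof.
apply/eqP; rewrite eq_le outer_refl_le/=.
by rewrite -[X in (lebesgue_outer X <= _)%E](preimage_point_reflK z) outer_refl_le.
Qed.

Lemma measurable_point_refl z : measurable_fun [set: Leb] (point_refl z).
Proof.
move=> _ A mA; rewrite setTI.
change (caratheodory_measurable (@lebesgue_outer R n) (point_refl z @^-1` A)) => X.
rewrite -(lebesgue_outer_point_refl z X) -(lebesgue_outer_point_refl z (X `&` _)).
rewrite -(lebesgue_outer_point_refl z (X `&` ~` _)).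
rewrite !preimage_setI preimage_setC !preimage_point_reflK.
exact: mA.
Qed.

Lemma ge0_integral_point_refl z (f : Leb -> \bar R) : measurable_fun setT f ->
  (forall y, 0 <= f y)%E -> (\int[leb]_y f (z - (y : Rn))%R = \int[leb]_y f y)%E.
Proof.
move=> mf f0.
have H := ge0_integral_pushforward (measurable_point_refl z) leb measurableT mf (fun y _ => f0 y).
rewrite preimage_setT in H; apply: (etrans (esym H)).
apply: (@eq_measure_integral _ _ _ setT leb
  (measure_function_pushforward__canonical__measure_function_Measure leb
    (measurable_point_refl z)) f).
by move=> A mA _; exact: lebesgue_outer_point_refl.
Qed.

Lemma integrable_point_refl z (f : Leb -> \bar R) : leb.-integrable setT f ->
  leb.-integrable setT (fun y => f (z - (y : Rn))%R).
Proof.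
move=> /integrableP[mf foo]; apply/integrableP; split.
  exact: (measurableT_comp mf (measurable_point_refl z)).
apply: le_lt_trans foo.
have mabsf : measurable_fun [set: Leb] (fun y : Leb => `|f y|%E) by exact: measurableT_comp.
by have -> := ge0_integral_point_refl z mabsf (fun y => abse_ge0 (f y)).
Qed.

Lemma integral_point_refl z (f : Leb -> \bar R) : leb.-integrable setT f ->
  (\int[leb]_y f (z - (y : Rn))%R = \int[leb]_y f y)%E.
Proof.
move=> intf; have mf := measurable_int _ intf.
have intrf := integrable_point_refl z intf.
rewrite -[X in leb.-integrable X](preimage_setT (point_refl z)) in intrf.
have H := integral_pushforward (measurable_point_refl z) mf intrf measurableT.
rewrite preimage_setT in H; apply: (etrans (esym H)).
apply: (@eq_measure_integral _ _ _ setT leb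
  (measure_function_pushforward__canonical__measure_function_Measure leb
    (measurable_point_refl z)) f).
by move=> A mA _; exact: lebesgue_outer_point_refl.
Qed.

End reflection.

(** * Integrals of the kernel away from, and near, its singularity *)

Section dyadic.
Variables (R : realType) (n : nat) (s : R).
Hypotheses (s_gt0 : 0 < s) (s_lt1 : s < 1).
Notation Rn := 'rV[R]_n.+1.
Notation Leb := (lebesgue_space R n).
Notation leb := (@lebesgue_rV R n).
Notation p := (n.+1%:R + 2 * s).

(** The complement of the open Euclidean ball of radius r around x. *)
Definition outside_ball (x : Rn) (r : R) : set Leb := [set y : Leb | r <= enorm (x - (y : Rn))].

Lemma measurable_outside_ball x r : measurable (outside_ball x r).
Proof.
rewrite -[X in measurable X]setTI.
by have := @measurable_enorm_l R n x measurableT `[r, +oo[%classic;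
  rewrite (_ : _ @^-1` _ = outside_ball x r)//;
  [apply|apply/seteqP; split=> y /=; rewrite /outside_ball/= in_itv/= andbT].
Qed.

Lemma nneseries_geometric (a q : R) : 0 <= a -> 0 < q -> q < 1 ->
  (\sum_(0 <= k <oo) (a * q ^+ k)%:E <= (a / (1 - q))%:E)%E.
Proof.
move=> a0 q0 q1; apply: lime_le.
  apply: is_cvg_nneseries => k _ _; rewrite lee_fin mulr_ge0// exprn_ge0// ltW//.
near=> m; rewrite sumEFin lee_fin.
apply: le_trans (geometric_le_lim m a0 q0 _); last by rewrite gtr0_norm.
by rewrite /series/= /geometric.
Unshelve. all: by end_near. Qed.

(** If each y in D lies in some cube of half-side r k around x with f y <= a k, then the
    integral of f is at most the sum of a k times the volumes of these cubes. Here these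
    products form a geometric sequence. *)
Lemma integral_le_cubes (x : Rn) (D : set Leb) (f : Leb -> R) (a r : nat -> R)
    (c q : R) :
  measurable D -> measurable_fun D f -> (forall y, D y -> 0 <= f y) ->
  (forall k, 0 <= a k) -> (forall k, 0 <= r k) ->
  (forall y, D y -> exists k, cube x (r k) y /\ f y <= a k) ->
  0 <= c -> 0 < q -> q < 1 ->
  (forall k, a k * (2 * r k) ^+ n.+1 = c * q ^+ k) ->
  (\int[leb]_(y in D) (f y)%:E <= (c / (1 - q))%:E)%E.
Proof.
move=> mD mf f0 a0 r0 fa c0 q0 q1 ar.
have mcube k : measurable (cube x (r k) : set Leb) by exact: measurable_cube.
pose g k (y : Leb) := (a k * \1_(cube x (r k)) y)%:E.
have g0 k y : (0 <= g k y)%E by rewrite lee_fin mulr_ge0// indicE.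
have mg k : measurable_fun setT (g k).
  by apply/measurable_EFinP; apply: measurable_funM => //; exact: measurable_indic.
have mgD k : measurable_fun D (g k) by exact: measurable_funTS.
apply: (@le_trans _ _ (\int[leb]_(y in D) \sum_(0 <= k <oo) g k y)%E).
  apply: (ge0_le_integral _ mD); first by move=> y Dy; rewrite lee_fin; exact: f0.
  - exact/measurable_EFinP.
  - by apply: measurable_nneseries => [k y _|k]; [exact: g0|exact: mgD].
  - move=> y Dy; have [k [xk fk]] := fa y Dy.
    rewrite (nneseriesD1 (n := k))//=.
    apply: (@le_trans _ _ (g k y)); last by rewrite leeDl// nneseries_ge0.
    by rewrite /g indicE mem_set// mulr1 lee_fin.
rewrite (integral_nneseries _ mD mgD (fun k y _ => g0 k y)).
apply: le_trans (nneseries_geometric c0 q0 q1).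
apply: lee_nneseries => [k _ _|k _].
  by apply: integral_ge0 => y _; exact: g0.
rewrite -ar.
apply: (@le_trans _ _ (\int[leb]_y g k y)%E).
  exact: (ge0_subset_integral _ mD measurableT (mg k) (fun y _ => g0 k y) (@subsetT _ _)).
under eq_integral do rewrite /g EFinM.
have mi : measurable_fun setT (fun y : Leb => (\1_(cube x (r k)) y)%:E : \bar R).
  by apply/measurable_EFinP; exact: measurable_indic.
have i0 (y : Leb) : setT y -> (0 <= (\1_(cube x (r k)) y)%:E :> \bar R)%E.
  by rewrite lee_fin indicE.
rewrite (ge0_integralZl_EFin _ measurableT i0 mi (a0 k)).
by rewrite (integral_indic _ measurableT (mcube k)) setIT EFinM [X in (_ * X <= _)%E]leb_cube.
Qed.

Lemma powR_pow2 (q : R) k : (2 ^+ k : R) `^ q = (2 `^ q) ^+ k.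
Proof.
elim: k => [|k IH]; first by rewrite !expr0 powR1.
by rewrite exprS powRM ?exprn_ge0// IH exprS.
Qed.

(** The kernel is integrable at infinity: on the shell r 2^k <= |x - y| < r 2^(k+1) it
    is at most (r 2^k)^-p, and p > d. *)
Lemma integral_tail (r : R) : 0 < r ->
  exists2 C, 0 <= C & forall x : Rn,
    (\int[leb]_(y in outside_ball x r) (rker s (x - (y : Rn))%R)%:E <= C%:E)%E.
Proof.
move=> r0; pose c := r `^ (- p) * (4 * r) ^+ n.+1; pose q : R := 2 `^ (- (2 * s)).
have q0 : 0 < q by exact: powR_gt0.
have q1 : q < 1.
  rewrite /q powRN invf_lt1 ?powR_gt0//.
  rewrite -[ltLHS](powRr0 2) /powR pnatr_eq0/=.
  by rewrite ltr_expR mul0r mulr_gt0 ?mulr_gt0// ln_gt0// ltr1n.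
have c0 : 0 <= c by rewrite mulr_ge0 ?powR_ge0// exprn_ge0// mulr_ge0// ltW.
exists (c / (1 - q)); first by rewrite divr_ge0// subr_ge0 ltW.
move=> x.
have mD := measurable_outside_ball x r.
apply: (@integral_le_cubes x _ _ (fun k => (r * 2 ^+ k) `^ (- p))
  (fun k => 2 * r * 2 ^+ k) c q mD _ _ _ _ _ c0 q0 q1).
- exact: measurable_funTS (@measurable_rker_l R n s x).
- by move=> y _; exact: rker_ge0.
- by move=> k; exact: powR_ge0.
- by move=> k; rewrite !mulr_ge0 ?exprn_ge0// ltW.
- move=> y /= ry.
  have ex : exists m, enorm (x - (y : Rn)) < r * 2 ^+ m.
    exists (Num.truncn (enorm (x - (y : Rn)) / r)).+1.
    rewrite mulrC -ltr_pdivrMr// (lt_trans (truncnS_gt _))//.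
    by rewrite -natrX ltr_nat ltn_expl.
  case: (ex_minnP ex) => -[|k] yk kmin.
    by move: yk; rewrite expr0 mulr1 ltNge ry.
  exists k; split.
    rewrite /cube/= (le_trans (norm_le_enorm _))//.
    by rewrite (le_trans (ltW yk))// exprS mulrCA mulrA.
  apply: rker_le => //; first by rewrite mulr_gt0// exprn_gt0.
  by rewrite leNgt; apply/negP => /kmin; rewrite ltnn.
- move=> k; rewrite powRM ?exprn_ge0 ?(ltW r0)//.
  rewrite powR_pow2 mulrA (_ : 2 * (2 * r) = 4 * r); last by ring.
  rewrite exprMn /c /q -!mulrA; congr (_ * _).
  rewrite mulrCA; congr (_ * _).
  rewrite -exprM mulnC exprM -exprMn; congr (_ ^+ _).
  rewrite -powR_mulrn// -powRD ?implybT//; last by rewrite pnatr_eq0 implybT.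
  by congr (_ `^ _); ring.
Qed.

(** The kernel times |x - y|^2 is integrable near the singularity, with the exponent
    given by scaling: d + 2 - p = 2 - 2 s. *)
Lemma integral_near :
  exists2 C, 0 <= C & forall (x : Rn) (rho : R), 0 < rho ->
    (\int[leb]_(y in ~` outside_ball x rho)
       (enorm (x - (y : Rn)) ^+ 2 * rker s (x - (y : Rn)))%R%:E
      <= (C * rho `^ (2 - 2 * s))%:E)%E.
Proof.
pose q : R := 2 `^ (- (2 - 2 * s)).
have s2 : 0 < 2 - 2 * s by rewrite subr_gt0 gtr_pMr.
have q0 : 0 < q by exact: powR_gt0.
have q1 : q < 1.
  rewrite /q powRN invf_lt1 ?powR_gt0//.
  rewrite -[ltLHS](powRr0 2) /powR pnatr_eq0/=.
  by rewrite ltr_expR mul0r mulr_gt0// ln_gt0// ltr1n.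
pose C := 2 `^ p * 2 ^+ n.+1 : R.
have C0 : 0 <= C by rewrite mulr_ge0 ?powR_ge0 ?exprn_ge0.
exists (C / (1 - q)); first by rewrite divr_ge0// subr_ge0 ltW.
move=> x rho rho0.
rewrite mulrAC; set c := C * _.
have c0 : 0 <= c by rewrite mulr_ge0 ?powR_ge0.
have mD := measurableC (measurable_outside_ball x rho).
apply: (@integral_le_cubes x _ _
  (fun k => (rho / 2 ^+ k) ^+ 2 * (rho / 2 ^+ k.+1) `^ (- p))
  (fun k => rho / 2 ^+ k) c q mD _ _ _ _ _ c0 q0 q1).
- apply: measurable_funTS; apply: measurable_funM.
    by apply: measurable_funX; exact: (@measurable_enorm_l R n x).
  exact: (@measurable_rker_l R n s x).
- by move=> y _; rewrite mulr_ge0 ?sqr_ge0 ?rker_ge0.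
- by move=> k; rewrite mulr_ge0 ?sqr_ge0 ?powR_ge0.
- by move=> k; rewrite divr_ge0 ?exprn_ge0// ltW.
- move=> y /= /negP; rewrite -ltNge => ry; have [xy0|] := eqVneq (x - (y : Rn)) 0.
    exists 0%N; rewrite xy0 rker0// mulr0; split.
      by rewrite /cube/= xy0 normr0 divr_ge0 ?exprn_ge0// ltW.
    by rewrite mulr_ge0 ?sqr_ge0 ?powR_ge0.
  rewrite -enorm_gt0 => e0.
  have ex : exists m, rho / 2 ^+ m <= enorm (x - (y : Rn)).
    exists (Num.truncn (rho / enorm (x - (y : Rn)))).+1.
    rewrite ler_pdivrMr ?exprn_gt0// mulrC -ler_pdivrMr//.
    rewrite (le_trans (ltW (truncnS_gt _)))//.
    by rewrite -natrX ler_nat ltnW// ltn_expl.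
  case: (ex_minnP ex) => -[|k] yk kmin.
    by move: yk; rewrite expr0 divr1 leNgt ry.
  have ke : enorm (x - (y : Rn)) <= rho / 2 ^+ k.
    by apply/ltW; rewrite ltNge; apply/negP => /kmin; rewrite ltnn.
  exists k; split.
    by rewrite /cube/= (le_trans (norm_le_enorm _)).
  apply: ler_pM => //; rewrite ?sqr_ge0 ?rker_ge0//.
    by rewrite lerXn2r// ?nnegrE ?enorm_ge0// divr_ge0 ?exprn_ge0// ltW.
  by apply: rker_le => //; rewrite divr_gt0 ?exprn_gt0.
- move=> k.
  have rk0 : 0 < rho / 2 ^+ k by rewrite divr_gt0// exprn_gt0.
  have -> : rho / 2 ^+ k.+1 = (rho / 2 ^+ k) * 2^-1.
    by rewrite exprSr invfM mulrA.
  rewrite [(2 * _) ^+ _]exprMn powRM ?invr_ge0 ?(ltW rk0)//.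
  have -> : (2^-1 : R) `^ (- p) = 2 `^ p.
    by rewrite -[X in X `^ _](powR_inv1)// -powRrM mulrNN mul1r.
  set t := rho / 2 ^+ k.
  have -> : t ^+ 2 * (t `^ (- p) * 2 `^ p) * (2 ^+ n.+1 * t ^+ n.+1) =
    C * (t `^ 2 * t `^ (- p) * t `^ n.+1%:R).
    by rewrite /C !powR_mulrn ?(ltW rk0)//; ring.
  rewrite -!powRD; last 2 first.
  - by rewrite (gt_eqF rk0) implybT.
  - by rewrite (gt_eqF rk0) implybT.
  have -> : 2 - p + n.+1%:R = 2 - 2 * s by ring.
  rewrite /c -mulrA; congr (_ * _).
  rewrite /t powRM ?invr_ge0 ?exprn_ge0 ?(ltW rho0)//; congr (_ * _).
  rewrite -[(2 ^+ k)^-1]powR_inv1 ?exprn_ge0// -powRrM mulN1r powR_pow2.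
  by [].
Qed.

End dyadic.

(** * Functions with continuous partial derivatives *)

Section calculus.
Variables (R : realType) (n : nat).
Notation Rn := 'rV[R]_n.+1.
Notation "''e_' i" := (delta_mx 0 i : Rn) (at level 8, i at level 2, format "''e_' i").
Implicit Types (phi : Rn -> R) (x y z : Rn).

Lemma is_derive_line phi z (v : Rn) (t : R) : derivable phi (t *: v + z) v ->
  is_derive t 1 (fun t => phi (t *: v + z)) ('D_v phi (t *: v + z)).
Proof.
move=> dphi.
have E : (fun h : R => h^-1 *: (((fun t => phi (t *: v + z)) \o shift t) (h *: 1) -
      phi (t *: v + z))) =
    (fun h : R => h^-1 *: ((phi \o shift (t *: v + z)) (h *: v) - phi (t *: v + z))).
  by apply/funext => h /=; rewrite [h *: 1]mulr1 scalerDl addrA.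
apply: DeriveDef; last by rewrite /derive E.
by rewrite /derivable E.
Qed.

(** The mean value theorem along a line, for increments of either sign. *)
Lemma MVT_line phi z (v : Rn) (h : R) :
  (forall t, Num.min 0 h <= t <= Num.max 0 h -> derivable phi (t *: v + z) v) ->
  exists2 t, Num.min 0 h <= t <= Num.max 0 h &
    phi (h *: v + z) - phi z = h * 'D_v phi (t *: v + z).
Proof.
move=> dphi.
have m01 : Num.min 0 h <= Num.max 0 h by rewrite ge_min !le_max lexx.
have [t] : exists2 t, t \in `[Num.min 0 h, Num.max 0 h] &
    phi (Num.max 0 h *: v + z) - phi (Num.min 0 h *: v + z) =
    'D_v phi (t *: v + z) * (Num.max 0 h - Num.min 0 h).
  apply: (@MVT_segment R (fun t => phi (t *: v + z)) (fun t => 'D_v phi (t *: v + z))) => //.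
    move=> t; rewrite in_itv/= => /andP[at_ tb]; apply: is_derive_line; apply: dphi.
    by rewrite !ltW.
  apply: derivable_within_continuous => t; rewrite in_itv/= => tab.
  by have := is_derive_line (dphi _ tab) => -[].
rewrite in_itv/= => tab E0; exists t => //.
have [h0|h0] := leP 0 h.
  move: E0; rewrite (max_idPr h0) (min_idPl h0) scale0r add0r subr0 => ->.
  by rewrite mulrC.
move: E0; rewrite (max_idPl (ltW h0)) (min_idPr (ltW h0)) scale0r add0r sub0r mulrN => E.
by apply: oppr_inj; rewrite opprB E mulrC.
Qed.

(** An increment is the sum of the increments along a path parallel to the axes, to each
    of which the mean value theorem applies; total differentiability is not needed. *)
Lemma sum_partial_increments phi x y :
  (forall z i, (forall j, Num.min (x 0 j) (y 0 j) <= z 0 j <= Num.max (x 0 j) (y 0 j)) ->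
     derivable phi z 'e_i) ->
  exists2 xi : 'I_n.+1 -> Rn,
    forall i j, Num.min (x 0 j) (y 0 j) <= xi i 0 j <= Num.max (x 0 j) (y 0 j) &
    phi y - phi x = \sum_i (y 0 i - x 0 i) * 'D_('e_i) phi (xi i).
Proof.
move=> dphi.
(* z k is the k-th vertex of the path: it has the first k coordinates of y. *)
pose z (k : nat) : Rn := \row_j if (j < k)%N then y 0 j else x 0 j.
have z0 : z 0%N = x by apply/rowP => j; rewrite mxE.
have zn : z n.+1 = y by apply/rowP => j; rewrite mxE ltn_ord.
have zS (i : 'I_n.+1) : z i.+1 = (y 0 i - x 0 i) *: 'e_i + z i.
  apply/rowP => j; rewrite !mxE eqxx/=.
  have [->|ij] := eqVneq j i; first by rewrite ltnSn ltnn mulr1 subrK.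
  rewrite ltnS leq_eqVlt (_ : (_ == _ :> nat) = false) ?mulr0 ?add0r//.
  exact/negbTE.
have zt (i : 'I_n.+1) (t : R) j : Num.min 0 (y 0 i - x 0 i) <= t <= Num.max 0 (y 0 i - x 0 i) ->
    Num.min (x 0 j) (y 0 j) <= (t *: 'e_i + z i) 0 j <= Num.max (x 0 j) (y 0 j).
  rewrite !mxE eqxx/= ge_min le_max; have [->|ij] := eqVneq j i.
    rewrite ltnn mulr1 ge_min le_max => /andP[/orP h1 /orP h2].
    by apply/andP; split; apply/orP; case: h1; case: h2 => ? ?;
      (try by left; lra); right; lra.
  move=> _; rewrite mulr0 add0r; case: ifP => _; rewrite ge_min le_max !lexx ?orbT//.
have /choice[t tP] (i : 'I_n.+1) : exists t : R,
    Num.min 0 (y 0 i - x 0 i) <= t <= Num.max 0 (y 0 i - x 0 i) /\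
    phi (z i.+1) - phi (z i) = (y 0 i - x 0 i) * 'D_('e_i) phi (t *: 'e_i + z i).
  rewrite zS; have [t|t tP tE] := @MVT_line phi (z i) 'e_i (y 0 i - x 0 i).
    by move=> tP; apply: dphi => j; exact: zt.
  by exists t.
exists (fun i => t i *: 'e_i + z i) => [i j|]; first by apply: zt; have [] := tP i.
rewrite -{1}zn -z0 -(telescope_sumr (fun k => phi (z k)))// big_mkord z0.
by apply: eq_bigr => i _; have [_] := tP i.
Qed.

Lemma sum_partial_increments_ball phi (a : Rn) (r : R) x y :
  (forall z, `|z - a| < r -> forall i, derivable phi z 'e_i) ->
  `|x - a| < r -> `|y - a| < r ->
  exists2 xi : 'I_n.+1 -> Rn,
    forall i, `|xi i - a| < r /\ `|xi i - x| <= `|y - x| &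
    phi y - phi x = \sum_i (y 0 i - x 0 i) * 'D_('e_i) phi (xi i).
Proof.
move=> dphi xa ya.
have r0 : 0 < r by exact: le_lt_trans xa.
pose m := Num.max `|x - a| `|y - a|.
have mr : m < r by rewrite gt_max xa.
have hull z : (forall j, Num.min (x 0 j) (y 0 j) <= z 0 j <= Num.max (x 0 j) (y 0 j)) ->
    `|z - a| < r /\ `|z - x| <= `|y - x|.
  move=> zP; split.
    apply: le_lt_trans mr; apply: norm_leP.
      by rewrite le_max normr_ge0.
    move=> j; have := coord_le_norm (x - a) j; have := coord_le_norm (y - a) j.
    have mx : `|x - a| <= m by rewrite le_max lexx.
    have my : `|y - a| <= m by rewrite le_max lexx orbT.
    have := zP j; rewrite !mxE ge_min le_max !ler_norml => /andP[/orP h1 /orP h2].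
    move=> /andP[? ?] /andP[? ?]; apply/andP.
    by split; case: h1; case: h2 => ? ?; lra.
  apply: norm_leP => // j; have := coord_le_norm (y - x) j.
  have := zP j; rewrite !mxE ge_min le_max !ler_norml => /andP[/orP h1 /orP h2].
  move=> /andP[? ?]; apply/andP.
  have := normr_ge0 (y - x) => ?.
  by split; case: h1; case: h2 => ? ?; lra.
have [z i zP|xi xiP E] := @sum_partial_increments phi x y.
  by apply: dphi; have [] := hull z zP.
by exists xi => // i; apply: hull.
Qed.

Lemma lipschitz_of_partials phi (a : Rn) (r M : R) x y :
  (forall z, `|z - a| < r -> forall i, derivable phi z 'e_i /\ `|'D_('e_i) phi z| <= M) ->
  `|x - a| < r -> `|y - a| < r -> `|phi y - phi x| <= n.+1%:R * M * `|y - x|.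
Proof.
move=> dphi xa ya.
have [|xi xiP ->] := @sum_partial_increments_ball phi a r x y _ xa ya.
  by move=> z za i; have [] := dphi z za i.
apply: le_trans (ler_norm_sum _ _ _) _.
apply: (@le_trans _ _ (\sum_(i < n.+1) `|y - x| * M)).
  apply: ler_sum => i _; rewrite normrM; apply: ler_pM => //.
    by have := coord_le_norm (y - x) i; rewrite !mxE.
  by have [/dphi/(_ i)[]] := xiP i.
by rewrite sumr_const card_ord -mulrA [M * _]mulrC mulr_natl.
Qed.

Lemma nbhs_norm_lt x (r : R) : 0 < r -> nbhs x [set y | `|y - x| < r].
Proof.
move=> r0; apply: filterS (nbhsx_ballx x r r0) => y.
by rewrite -ball_normE/= distrC.
Qed.

(** Continuity at x of a real function on R^d, with epsilon and delta. *)
Lemma continuous_normP (f : Rn -> R) x : {for x, continuous f} <->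
  forall e, 0 < e -> exists2 r, 0 < r & forall y, `|y - x| < r -> `|f x - f y| <= e.
Proof.
have fx : Filter (nbhs x) by exact: nbhs_filter.
split=> [/(@cvgrPdist_le _ _ _ (nbhs x) fx f (f x)) cf e e0|cf].
  have /nbhs_ballP[r/= r0 rP] := cf e e0; exists r => // y yx.
  by apply: rP; rewrite -ball_normE/= distrC.
apply/(@cvgrPdist_le _ _ _ (nbhs x) fx f (f x)) => e e0.
have [r r0 rP] := cf e e0.
exact: filterS (nbhs_norm_lt x r0).
Qed.

Lemma near_bounded (f : Rn -> R) (x : Rn) :
  {for x, continuous f} -> \forall y \near x, `|f y| <= `|f x| + 1.
Proof.
move=> /cvgrPdist_le /(_ _ ltr01); apply: filterS => y.
rewrite distrC => fxy; rewrite -[f y](subrK (f x)).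
by apply: le_trans (ler_normD _ _) _; rewrite addrC lerD2l.
Qed.

Lemma C1_on_continuous_partial (U : set Rn) phi x i : open U -> C1_on U phi -> U x ->
  {for x, continuous ('D_('e_i) phi)}.
Proof.
move=> oU C1 Ux; have [_] := C1 i.
by rewrite continuous_open_subspace// => /(_ x); apply; rewrite inE.
Qed.

Lemma C1_on_bounded_partials (U : set Rn) phi x : open U -> C1_on U phi -> U x ->
  exists2 M, 0 <= M & \forall z \near x, forall i,
    derivable phi z 'e_i /\ `|'D_('e_i) phi z| <= M.
Proof.
move=> oU C1 Ux.
exists (\sum_(i < n.+1) (`|'D_('e_i) phi x| + 1)).
  by apply: sumr_ge0 => i _; rewrite addr_ge0.
have fx : Filter (nbhs x) by exact: nbhs_filter.
have H i : \forall z \near x, derivable phi z 'e_i /\ `|'D_('e_i) phi z| <=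
    \sum_(i < n.+1) (`|'D_('e_i) phi x| + 1).
  apply: (@filterS2 _ _ _ U (fun z => `|'D_('e_i) phi z| <= `|'D_('e_i) phi x| + 1)).
  - move=> z Uz zle; split; first by have [+ _] := C1 i; exact.
    by apply: le_trans zle _; rewrite [leRHS](bigD1 i)//= lerDl sumr_ge0// => j _; rewrite addr_ge0.
  - exact: open_nbhs_nbhs.
  - exact: near_bounded (C1_on_continuous_partial (i := i) oU C1 Ux).
exact: filter_forall H.
Qed.

Lemma C1_on_continuous (U : set Rn) phi x : open U -> C1_on U phi -> U x ->
  {for x, continuous phi}.
Proof.
move=> oU C1 Ux; have [M M0] := C1_on_bounded_partials oU C1 Ux.
move=> /nbhs_ballP[r/= r0 rP].
have dphi z : `|z - x| < r -> forall i, derivable phi z 'e_i /\ `|'D_('e_i) phi z| <= M.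
  by move=> zx; apply: rP; rewrite -ball_normE/= distrC.
pose L := n.+1%:R * M + 1; have L0 : 0 < L by rewrite ltr_wpDl// mulr_ge0.
apply/continuous_normP => e e0; exists (Num.min r (e / L)).
  by rewrite lt_min r0 divr_gt0.
move=> y; rewrite lt_min => /andP[yx ye].
rewrite distrC; apply: le_trans (lipschitz_of_partials dphi _ yx) _.
  by rewrite subrr normr0.
apply: (@le_trans _ _ (L * `|y - x|)); first by rewrite ler_wpM2r// lerDl.
by rewrite mulrC -ler_pdivlMr// ltW.
Qed.

(** Second symmetric differences of a C^2 function are O(|x - y|^2), uniformly for x near
    a: the first-order Taylor remainders at y and at 2 x - y are controlled by the
    Lipschitz constants of the partial derivatives, and the linear terms cancel. *)
Lemma C2_symmetric_difference (U : set Rn) phi (a : Rn) : open U -> C2_on U phi -> U a ->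
  exists r : R, [/\ 0 < r, (forall z, `|z - a| < r -> U z) & exists2 C, 0 <= C &
    forall x y, `|x - a| < r / 2 -> `|x - y| < r / 2 ->
      `|2 * phi x - phi y - phi (x *+ 2 - y)| <= C * `|x - y| ^+ 2].
Proof.
move=> oU [C1 C2] Ua.
have [r0 r0_gt0 rU] : exists2 r, 0 < r & forall z, `|z - a| < r -> U z.
  have /nbhs_ballP[r/= r_gt0 rP] : nbhs a U by exact: open_nbhs_nbhs.
  by exists r => // z za; apply: rP; rewrite -ball_normE/= distrC.
have /choice[M MP] i : exists M, 0 <= M /\ exists2 r, 0 < r & forall z, `|z - a| < r ->
    forall j, derivable ('D_('e_i) phi) z 'e_j /\ `|'D_('e_j) ('D_('e_i) phi) z| <= M.
  have [M M0 /nbhs_ballP[r/= r_gt0 rP]] := C1_on_bounded_partials oU (C2 i) Ua.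
  exists M; split=> //; exists r => // z za; apply: rP.
  by rewrite -ball_normE/= distrC.
have /choice[rr rrP] i : exists r, 0 < r /\ forall z, `|z - a| < r ->
    forall j, derivable ('D_('e_i) phi) z 'e_j /\ `|'D_('e_j) ('D_('e_i) phi) z| <= M i.
  by have [_ [r ? ?]] := MP i; exists r.
pose r := \big[Num.min/r0]_i rr i.
have r_gt0 : 0 < r by apply: lt_bigmin => // i _; have [] := rrP i.
have rr0 : r <= r0 by exact: bigmin_le_id.
have rri i : r <= rr i by exact: bigmin_le.
have zU z : `|z - a| < r -> U z by move=> za; apply: rU; exact: lt_le_trans rr0.
exists r; split => //.
pose C := \sum_i n.+1%:R * M i.
have C0 : 0 <= C by apply: sumr_ge0 => i _; rewrite mulr_ge0//; have [] := MP i.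
exists (C + C); first exact: addr_ge0.
move=> x y xa xy.
have r2 : r / 2 < r by rewrite ltr_pdivrMr// ltr_pMr// ltr1n.
have xar : `|x - a| < r by exact: lt_trans r2.
have taylor w : `|w - x| < r / 2 ->
    `|phi w - phi x - \sum_i (w 0 i - x 0 i) * 'D_('e_i) phi x| <= C * `|w - x| ^+ 2.
  move=> wx.
  have war : `|w - a| < r.
    have -> : w - a = (w - x) + (x - a) by rewrite addrA subrK.
    by apply: le_lt_trans (ler_normD _ _) _; lra.
  have [|xi xiP ->] := @sum_partial_increments_ball phi a r x w _ xar war.
    by move=> z za i; have [+ _] := C1 i; apply; exact: zU.
  rewrite -sumrB; apply: le_trans (ler_norm_sum _ _ _) _.
  rewrite /C mulr_suml; apply: ler_sum => i _.
  rewrite -mulrBr normrM expr2 mulrA [leLHS]mulrC; apply: ler_pM => //; last first.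
    by have := coord_le_norm (w - x) i; rewrite !mxE.
  have [xia xix] := xiP i.
  apply: (@le_trans _ _ (n.+1%:R * M i * `|xi i - x|)).
    have [_ rriP] := rrP i.
    exact: (lipschitz_of_partials (phi := 'D_('e_i) phi) rriP
      (lt_le_trans xar (rri i)) (lt_le_trans xia (rri i))).
  by rewrite ler_wpM2l// mulr_ge0//; have [] := MP i.
have t1 := taylor y; have t2 := taylor (x *+ 2 - y).
have E2 : x *+ 2 - y - x = x - y by rewrite mulr2n addrAC addrK.
rewrite E2 in t2; rewrite distrC in xy; have {}t1 := t1 xy.
rewrite distrC in xy; have {}t2 := t2 xy.
rewrite [`|y - x|]distrC in t1.
set S1 := \sum_i _ in t1; set S2 := \sum_i _ in t2.
have S12 : S2 = - S1.
  rewrite -sumrN; apply: eq_bigr => i _; rewrite -mulNr; congr (_ * _).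
  by rewrite !mxE; lra.
have -> : 2 * phi x - phi y - phi (x *+ 2 - y) =
  - ((phi y - phi x - S1) + (phi (x *+ 2 - y) - phi x - S2)) by rewrite S12; ring.
rewrite normrN mulrDl; apply: le_trans (ler_normD _ _) _.
exact: lerD.
Qed.

End calculus.

(** * Truncated fractional Laplacians *)

Lemma integrable_dominated d (T : measurableType d) (R : realType)
    (mu : {measure set T -> \bar R}) (f g : T -> R) :
  measurable_fun setT f -> (forall y, `|f y| <= g y) ->
  mu.-integrable setT (EFin \o g) -> mu.-integrable setT (EFin \o f).
Proof.
move=> mf fg; apply: (le_integrable measurableT).
  exact/measurable_EFinP.
by move=> y _ /=; rewrite lee_fin (le_trans (fg y))// ler_norm.
Qed.

Section real_integrable.
Context d (T : measurableType d) (R : realType) (mu : {measure set T -> \bar R}).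
Implicit Types f g : T -> R.

Lemma integrable_add f g : mu.-integrable setT (EFin \o f) ->
  mu.-integrable setT (EFin \o g) -> mu.-integrable setT (EFin \o (fun y => f y + g y)).
Proof. by move=> fi gi; exact: (integrableD measurableT fi gi). Qed.

Lemma integrable_scale (k : R) f : mu.-integrable setT (EFin \o f) ->
  mu.-integrable setT (EFin \o (fun y => k * f y)).
Proof. by move=> fi; exact: (integrableZl measurableT k fi). Qed.

Lemma integrable_abs f : mu.-integrable setT (EFin \o f) ->
  mu.-integrable setT (EFin \o (fun y => `|f y|)).
Proof. by move=> fi; exact: (integrable_abse fi). Qed.

End real_integrable.

Section weighted.
Variables (R : realType) (n : nat) (s : R).
Hypotheses (s_gt0 : 0 < s) (s_lt1 : s < 1).
Notation Rn := 'rV[R]_n.+1.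
Notation Leb := (lebesgue_space R n).
Notation leb := (@lebesgue_rV R n).
Notation p := (n.+1%:R + 2 * s).
Implicit Types (g : Rn -> R) (x y : Rn) (t : R -> R).

Lemma indic_outside_ball x r y : (\1_(outside_ball x r) y : R) = (r <= enorm (x - y))%R%:R.
Proof.
rewrite indicE; case: (boolP (r <= _)) => [xy|/negP xy]; first by rewrite mem_set.
by rewrite memNset.
Qed.

Lemma integrable_indic_outside_ball_rker x (r : R) : 0 < r ->
  leb.-integrable setT (EFin \o (fun y : Leb => \1_(outside_ball x r) y * rker s (x - (y : Rn)))).
Proof.
move=> r0; have [C C0 CP] := integral_tail n s_gt0 r0.
have mr := @measurable_rker_l R n s x.
have mf : measurable_fun setT (fun y : Leb => \1_(outside_ball x r) y * rker s (x - (y : Rn)) : R).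
  by apply: measurable_funM; [apply: measurable_indic; exact: measurable_outside_ball|exact: mr].
apply/integrableP; split; first exact/measurable_EFinP.
apply: le_lt_trans (ltry C); apply: le_trans (CP x).
rewrite [leRHS]integral_mkcond.
rewrite le_eqVlt; apply/orP; left; apply/eqP; apply: eq_integral => y _ /=.
rewrite patchE indicE; case: ifPn => _; last by rewrite mul0r normr0.
by rewrite mul1r ger0_norm// rker_ge0.
Qed.

Lemma integrable_indic_cube x (r : R) : 0 <= r ->
  leb.-integrable setT (EFin \o (\1_(cube x r) : Leb -> R)).
Proof.
move=> r0; have mc := @measurable_cube R n x r r0.
apply/integrableP; split; first by apply/measurable_EFinP; exact: measurable_indic.
rewrite (eq_integral (fun y : Leb => (\1_(cube x r) y)%:E)); last first.
  by move=> y _ /=; rewrite ger0_norm// indicE.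
by rewrite (integral_indic _ measurableT mc) setIT [X in (X < _)%E]leb_cube// ltry.
Qed.

Lemma integrable_wgt : leb.-integrable setT (EFin \o (wgt s : Leb -> R)).
Proof.
have [C C0 CP] := wgt_le_rker n s_gt0 (lexx 0).
apply: (integrable_dominated (g := fun y : Leb =>
    \1_(cube 0 1) y + C * (\1_(outside_ball 0 1) y * rker s (0 - (y : Rn))))).
- exact: measurable_wgt.
- move=> y; rewrite ger0_norm; last exact/ltW/wgt_gt0.
  rewrite !indicE; have [ycube|] := boolP (y \in cube 0 1).
    rewrite (le_trans (wgt_le1 _ _))// lerDl mulr_ge0// mulr_ge0// ?rker_ge0//.
  move/negP => ycube.
  have y1 : 1 <= enorm (0 - (y : Rn)).
    rewrite leNgt; apply/negP => y1; apply: ycube; rewrite inE /cube/=.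
    exact: le_trans (norm_le_enorm _) (ltW y1).
  rewrite mem_set// mul1r add0r; apply: CP; first by rewrite normr0.
  by rewrite eq_sym -subr_eq0 subr0 -enorm_gt0 -enormN -sub0r (lt_le_trans ltr01).
- apply: (integrable_add (integrable_indic_cube 0 ler01)).
  exact: (integrable_scale C (integrable_indic_outside_ball_rker 0 ltr01)).
Qed.

(** Measurable functions integrable against the weight of L^1_s; the truncated operators
    are defined on them. *)
Definition weighted_L1 g := measurable_fun [set: Leb] (g : Leb -> R) /\
  leb.-integrable setT (EFin \o (fun y : Leb => g y * wgt s y)).

(** The dominating function of the truncated integrands at the points x of a bounded set
    at which |g x| <= M. *)
Definition majorant (M C : R) g : Leb -> R := fun y => C * (M * wgt s y + `|g y| * wgt s y).

Lemma integrable_majorant M C g : weighted_L1 g -> leb.-integrable setT (EFin \o majorant M C g).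
Proof.
move=> [mg ig]; apply: integrable_scale; apply: integrable_add.
  exact: (integrable_scale M integrable_wgt).
apply: (integrable_dominated (g := fun y : Leb => `|g y * wgt s y|)).
- apply: measurable_funM; last exact: measurable_wgt.
  exact: measurableT_comp.
- by move=> y; rewrite !normrM normr_id.
- exact: (integrable_abs ig).
Qed.

Lemma majorant_ge0 M C g y : 0 <= M -> 0 <= C -> 0 <= majorant M C g y.
Proof.
move=> M0 C0; have := ltW (wgt_gt0 s (y : Rn)) => w0.
by rewrite /majorant mulr_ge0 ?addr_ge0 ?mulr_ge0.
Qed.

(** The truncated operators with a radial cut-off t: the integrand is
    (g x - g y) |x - y|^-p t(|x - y|). *)
Definition cut_integrand t g x : Leb -> R := fun y =>
  (g x - g y) * rker s (x - (y : Rn)) * t (enorm (x - (y : Rn))).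

Definition cut_fraclap t g x : R := \int[leb]_y cut_integrand t g x y.

(** Cut-offs that vanish at distances less than eps. *)
Definition cutoff (eps : R) t := [/\ measurable_fun setT t, forall e, `|t e| <= 1 &
  forall e, e < eps -> t e = 0].

Lemma measurable_cut_integrand eps t g x : cutoff eps t -> measurable_fun setT (g : Leb -> R) ->
  measurable_fun setT (cut_integrand t g x).
Proof.
move=> [mt _ _] mg; apply: measurable_funM; last first.
  exact: (measurableT_comp mt (@measurable_enorm_l R n x)).
apply: measurable_funM; last exact: measurable_rker_l.
exact: measurable_funB.
Qed.

Lemma cut_integrand_le_majorant (rho eps : R) : 0 <= rho -> 0 < eps ->
  exists2 C, 0 <= C & forall t g M x y, cutoff eps t -> 0 <= M -> `|x| <= rho ->
    `|g x| <= M -> `|cut_integrand t g x y| <= majorant M C g y.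
Proof.
move=> rho0 eps0; have [C C0 CP] := rker_le_wgt n s_gt0 rho0 eps0.
exists C => // t g M x y [_ t1 t0] M0 xrho gM.
have [ey|ey] := ltP (enorm (x - y)) eps.
  by rewrite /cut_integrand t0// mulr0 normr0 majorant_ge0.
rewrite /cut_integrand !normrM; apply: (@le_trans _ _ ((M + `|g y|) * (C * wgt s y))).
  rewrite -[leRHS]mulr1 ler_pM// ?mulr_ge0//.
  rewrite ler_pM//; last by rewrite ger0_norm ?rker_ge0//; exact: CP.
  by apply: le_trans (ler_normB _ _) _; rewrite lerD2r.
by rewrite /majorant -mulrDl mulrCA.
Qed.

Lemma integrable_cut_integrand eps t g x : 0 < eps -> cutoff eps t -> weighted_L1 g ->
  leb.-integrable setT (EFin \o cut_integrand t g x).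
Proof.
move=> eps0 wt gP.
have [C C0 CP] := cut_integrand_le_majorant (normr_ge0 x) eps0.
apply: (integrable_dominated (g := majorant `|g x| C g)).
- by apply: measurable_cut_integrand wt _; have [] := gP.
- move=> y; exact: CP.
- exact: integrable_majorant.
Qed.

Lemma cut_fraclapB eps t1 t2 g x : 0 < eps -> cutoff eps t1 -> cutoff eps t2 -> weighted_L1 g ->
  cut_fraclap t1 g x - cut_fraclap t2 g x = \int[leb]_y cut_integrand (fun e => t1 e - t2 e) g x y.
Proof.
move=> eps0 w1 w2 gP.
rewrite -(RintegralB measurableT (integrable_cut_integrand x eps0 w1 gP)
  (integrable_cut_integrand x eps0 w2 gP)).
by apply: eq_Rintegral => y _; rewrite /cut_integrand mulrBr.
Qed.

(** Second symmetric differences of g at x are at most C |x - y|^2. *)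
Definition symdiff_bound C r g x := forall y, `|x - y| < r ->
  `|2 * g x - g y - g (x *+ 2 - y)| <= C * `|x - y| ^+ 2.

(** Averaging the integrand at y and at 2 x - y replaces g x - g y by half a second
    symmetric difference. *)
Lemma cut_fraclap_near : exists2 C0, 0 <= C0 &
  forall C r rho eps t g x, 0 < eps -> 0 < rho -> rho <= r -> 0 <= C ->
    cutoff eps t -> (forall e, rho <= e -> t e = 0) -> weighted_L1 g ->
    symdiff_bound C r g x ->
    `|cut_fraclap t g x| <= C * C0 * rho `^ (2 - 2 * s).
Proof.
have [C0 C00 C0P] := integral_near n s_gt0 s_lt1.
exists C0 => // C r rho eps t g x eps0 rho0 rr C0_ wt trho gP sd.
have [mt t1 t0] := wt.
have iw := integrable_cut_integrand x eps0 wt gP.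
have iwr := integrable_point_refl (x *+ 2) iw.
have wopr : cut_fraclap t g x = \int[leb]_y cut_integrand t g x (x *+ 2 - (y : Rn)).
  by rewrite /cut_fraclap /Rintegral; congr fine; rewrite -(integral_point_refl (x *+ 2) iw).
have xr (y : Rn) : x - (x *+ 2 - y) = - (x - y).
  by rewrite !opprB mulr2n opprD addrCA addNKr.
pose D (y : Leb) := (2 * g x - g (y : Rn) - g (x *+ 2 - (y : Rn))) *
     rker s (x - (y : Rn)) * t (enorm (x - (y : Rn))).
have DE : D = (fun y => cut_integrand t g x y + cut_integrand t g x (x *+ 2 - (y : Rn))).
  by apply/funext => y; rewrite /D /cut_integrand xr rkerN enormN; ring.
have wopD : cut_fraclap t g x *+ 2 = \int[leb]_y D y.
  by rewrite mulr2n {2}wopr -(RintegralD measurableT iw iwr) DE.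
have iD : leb.-integrable setT (EFin \o D).
  by rewrite DE; exact: (integrable_add iw iwr).
pose h (y : Leb) := enorm (x - (y : Rn)) ^+ 2 * rker s (x - (y : Rn)).
have mfar : measurable (~` outside_ball x rho).
  by apply: measurableC; exact: measurable_outside_ball.
have mh : measurable_fun setT h.
  apply: measurable_funM; last exact: measurable_rker_l.
  by apply: measurable_funX; exact: measurable_enorm_l.
have h0 y : 0 <= h y by rewrite mulr_ge0 ?sqr_ge0 ?rker_ge0.
have ih : (\int[leb]_(y in ~` outside_ball x rho) (C * h y)%:E <=
    (C * C0 * rho `^ (2 - 2 * s))%:E)%E.
  under eq_integral do rewrite EFinM.
  have mhD : measurable_fun (~` outside_ball x rho) (EFin \o h).
    by apply/measurable_EFinP; exact: measurable_funTS.
  have h0D y : (~` outside_ball x rho) y -> (0 <= (EFin \o h) y)%E by rewrite lee_fin.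
  rewrite (ge0_integralZl_EFin _ mfar h0D mhD C0_).
  by rewrite -mulrA EFinM lee_wpmul2l// ?lee_fin//; exact: C0P.
have le2 : `|cut_fraclap t g x *+ 2| <= C * C0 * rho `^ (2 - 2 * s).
  rewrite wopD -lee_fin; apply: le_trans ih.
  rewrite (EFin_normr_Rintegral measurableT iD).
  apply: le_trans (le_abse_integral _ measurableT (measurable_int _ iD)) _.
  rewrite [leRHS]integral_mkcond.
  apply: (ge0_le_integral _ measurableT).
  - by move=> y _; exact: abse_ge0.
  - exact: (measurable_int _ (integrable_abse iD)).
  - apply/(measurable_restrictT _ mfar).
    apply/measurable_EFinP; apply: measurable_funM => //; exact: measurable_funTS.
  move=> y _ /=; rewrite patchE; case: ifPn => [|] yfar.
    move: yfar; rewrite inE /outside_ball/= => /negP; rewrite -ltNge => yfar.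
    rewrite lee_fin !normrM -[leRHS]mulr1 ler_pM// ?mulr_ge0//.
    rewrite /h mulrA (ger0_norm (rker_ge0 _ _)) ler_wpM2r ?rker_ge0//.
    have xyr : `|x - (y : Rn)| <= enorm (x - (y : Rn)) by exact: norm_le_enorm.
    apply: le_trans (sd y (le_lt_trans xyr (lt_le_trans yfar rr))) _.
    by rewrite ler_wpM2l// lerXn2r// ?nnegrE ?enorm_ge0.
  move: yfar; rewrite notin_setE /outside_ball/= => /contrapT yfar.
  by rewrite /D trho// mulr0 normr0.
apply: le_trans le2; rewrite normrMn.
by rewrite mulr2n lerDl.
Qed.

(** The cut-off of the principal value, and a continuous one, which is 0 up to a, 1 from
    2 a on, and affine in between. *)
Definition sharp (eps e : R) : R := (eps <= e)%R%:R.
Definition ramp (a e : R) : R := Num.min 1 (Num.max 0 (e / a - 1)).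

Lemma cutoff_sharp eps : cutoff eps (sharp eps).
Proof.
split.
- apply: nondecreasing_measurable => // x y xy; rewrite /sharp ler_nat.
  by case: (leP eps x) => // ex; rewrite (le_trans ex).
- by move=> e; rewrite /sharp; case: (eps <= e); rewrite ?normr1 ?normr0.
- by move=> e ee; rewrite /sharp leNgt ee.
Qed.

Lemma ramp01 a e : 0 <= ramp a e <= 1.
Proof. by rewrite /ramp le_min ler01 le_max lexx/= ge_min lexx. Qed.

Lemma ramp0 a e : 0 < a -> e <= a -> ramp a e = 0.
Proof.
move=> a0 ea; rewrite /ramp (max_idPl _) ?min_r//.
by rewrite subr_le0 ler_pdivrMr// mul1r.
Qed.

Lemma ramp1 a e : 0 < a -> 2 * a <= e -> ramp a e = 1.
Proof.
move=> a0 ea; rewrite /ramp min_l// le_max lerBrDr; apply/orP; right.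
by rewrite ler_pdivlMr.
Qed.

Lemma continuous_ramp a : continuous (ramp a).
Proof.
have -> : ramp a = (cst 1 : R -> R^o) \min ((cst 0 : R -> R^o) \max (fun e => e / a - 1 : R^o)).
  by apply/funext.
move=> e; apply: continuous_min; first exact: cst_continuous.
apply: continuous_max; first exact: cst_continuous.
apply: cvgB; last exact: cvg_cst.
by apply: cvgM; [exact: cvg_id|exact: cvg_cst].
Qed.

Lemma cutoff_ramp a : 0 < a -> cutoff a (ramp a).
Proof.
move=> a0; split.
- apply: nondecreasing_measurable => // x y xy; rewrite /ramp.
  apply: le_min2 => //; apply: le_max2 => //.
  by rewrite lerD2r ler_pM2r// invr_gt0.
- by move=> e; have /andP[? ?] := ramp01 a e; rewrite ger0_norm.
- by move=> e /ltW; exact: ramp0.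
Qed.

Lemma cutoffW eps eps' t : eps' <= eps -> cutoff eps t -> cutoff eps' t.
Proof.
by move=> ee [mt t1 t0]; split=> // e e'; apply: t0; exact: lt_le_trans ee.
Qed.

(** The difference of the two cut-offs is itself a cut-off, supported in |x - y| < 2 a. *)
Lemma cut_fraclap_sharp_ramp : exists2 C0, 0 <= C0 &
  forall C r a eps g x, 0 < eps -> eps <= a -> 2 * a <= r -> 0 <= C ->
    weighted_L1 g -> symdiff_bound C r g x ->
    `|cut_fraclap (sharp eps) g x - cut_fraclap (ramp a) g x| <= C * C0 * (2 * a) `^ (2 - 2 * s).
Proof.
have [C0 C00 C0P] := cut_fraclap_near.
exists C0 => // C r a eps g x eps0 epsa ar C_0 gP sd.
have a0 : 0 < a by exact: lt_le_trans epsa.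
have [mt1 t11 t10] := cutoff_sharp eps.
have wr := cutoffW epsa (cutoff_ramp a0).
have [mt2 t21 t20] := wr.
rewrite (cut_fraclapB x eps0 (cutoff_sharp eps) wr gP).
apply: (C0P C r (2 * a) eps (fun e => sharp eps e - ramp a e)) => //.
- by rewrite mulr_gt0.
- split.
  + exact: measurable_funB.
  + move=> e; have /andP[? ?] := ramp01 a e.
    rewrite ler_norml /sharp; case: (eps <= e); rewrite /= ?mulr1n ?mulr0n;
    by apply/andP; split; lra.
  + by move=> e ee; rewrite t10// t20// subr0.
- move=> e ae; rewrite ramp1// /sharp (le_trans epsa) ?subrr//.
  by rewrite (le_trans _ ae)// ler_peMl ?ltW// ltr1n.
Qed.

Lemma continuous_rker_ramp a : 0 < a ->
  continuous (fun h : Rn => rker s h * ramp a (enorm h)).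
Proof.
move=> a0.
have cpsi (e : R) : {for e, continuous (fun e : R => e `^ (- p) * ramp a e)}.
  have [ea|ea] := ltP e a.
    apply/cvgrPdist_le => d d0; near=> f.
    rewrite !ramp0 ?(ltW ea)// ?mulr0 ?subrr ?normr0 ?(ltW d0)//.
    apply/ltW; near: f; exact: lt_nbhsl.
  apply: cvgM; last exact: continuous_ramp.
  have d : derivable (fun e : R => e `^ (- p)) e 1.
    by apply: derivable_powR; rewrite in_itv/= andbT (lt_le_trans a0).
  exact: (differentiable_continuous ((derivable1_diffP _ _).1 d)).
have -> : (fun h : Rn => rker s h * ramp a (enorm h)) =
    (fun e : R => e `^ (- p) * ramp a e) \o (@enorm R n).
  by apply/funext => h /=; rewrite rker_powR.
by move=> h; apply: continuous_comp; [exact: continuous_enorm|exact: cpsi].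
Unshelve. all: by end_near. Qed.

(** Continuity in the base point, by dominated convergence along a sequence. The
    function g need not be continuous at any point other than x0. *)
Lemma cut_fraclap_ramp_continuous a g x0 : 0 < a -> weighted_L1 g -> {for x0, continuous g} ->
  forall eta, 0 < eta -> exists2 rho, 0 < rho &
    forall x, `|x - x0| < rho -> `|cut_fraclap (ramp a) g x - cut_fraclap (ramp a) g x0| <= eta.
Proof.
move=> a0 gP cg eta eta0; apply: contrapT => nex.
have [b b0 bP] := (continuous_normP g x0).1 cg 1 ltr01.
have /choice[z zP] (k : nat) : exists x, `|x - x0| < Num.min (Num.min b 1) k.+1%:R^-1 /\
    eta < `|cut_fraclap (ramp a) g x - cut_fraclap (ramp a) g x0|.
  apply: contrapT => nz; apply: nex.
  exists (Num.min (Num.min b 1) k.+1%:R^-1); first by rewrite !lt_min b0 ltr01 invr_gt0 ltr0Sn.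
  move=> x xz; rewrite leNgt; apply/negP => ez; apply: nz; by exists x.
have zb k : `|z k - x0| < b by have [+ _] := zP k; rewrite !lt_min => /andP[/andP[? _] _].
have z1 k : `|z k - x0| < 1 by have [+ _] := zP k; rewrite !lt_min => /andP[/andP[_ ?] _].
have zk k : `|z k - x0| < k.+1%:R^-1 by have [+ _] := zP k; rewrite !lt_min => /andP[_ ?].
have zcvg (f : Rn -> R) x : {for x, continuous f} -> forall (h : nat -> Rn),
    (forall k, `|h k - x| < k.+1%:R^-1) -> f (h k) @[k --> \oo] --> f x.
  move=> /(continuous_normP f x) cf h hk; apply/cvgrPdist_le => e e0.
  have [r r0 rP] := cf e e0; near=> k; apply: rP; apply: lt_trans (hk k) _.
  near: k; exact: near_infty_natSinv_lt (PosNum r0).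
have [C C0 CP] := cut_integrand_le_majorant (addr_ge0 (normr_ge0 x0) ler01) a0.
pose M := `|g x0| + 1.
have M0 : 0 <= M by rewrite addr_ge0.
have wr := cutoff_ramp a0.
have domz k y : `|cut_integrand (ramp a) g (z k) y| <= majorant M C g y.
  apply: CP => //.
    rewrite -[z k](subrK x0) addrC; apply: le_trans (ler_normD _ _) _.
    by rewrite lerD2l ltW.
  rewrite -[g (z k)](subrK (g x0)) addrC; apply: le_trans (ler_normD _ _) _.
  by rewrite lerD2l distrC; exact: bP.
have mw k : measurable_fun setT (EFin \o cut_integrand (ramp a) g (z k)).
  by apply/measurable_EFinP; apply: measurable_cut_integrand wr _; have [] := gP.
have cw y : setT y -> (EFin \o cut_integrand (ramp a) g (z k)) y @[k --> \oo] -->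
    (EFin \o cut_integrand (ramp a) g x0) y.
  move=> _; apply: cvg_EFin; first by near=> k.
  rewrite /cut_integrand/=; under eq_fun do rewrite -mulrA; rewrite -mulrA.
  apply: cvgM; first by apply: cvgB; [exact: zcvg cg _ zk|exact: cvg_cst].
  apply: (zcvg _ _ (continuous_rker_ramp a0 (x := x0 - (y : Rn))) (fun k => z k - (y : Rn))).
  by move=> k; rewrite opprB addrA subrK.
have df y : setT y -> (EFin \o majorant M C g) y \is a fin_num by [].
have dz k y : setT y ->
    (`|(EFin \o cut_integrand (ramp a) g (z k)) y| <= (EFin \o majorant M C g) y)%E.
  by move=> _; rewrite lee_fin; exact: domz.
have := dominated_cvg measurableT mw cw df (integrable_majorant M C gP) dz.
move=> cint.
have iz k := integrable_cut_integrand (z k) a0 wr gP.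
have i0 := integrable_cut_integrand x0 a0 wr gP.
have : cut_fraclap (ramp a) g (z k) @[k --> \oo] --> cut_fraclap (ramp a) g x0.
  apply: fine_cvg; rewrite /cut_fraclap /Rintegral fineK; last first.
    exact: (integrable_fin_num measurableT i0).
  exact: cint.
move=> /cvgrPdist_le /(_ eta eta0) [N _ /(_ N (leqnn N))].
by rewrite distrC leNgt; have [_ ->] := zP N.
Unshelve. all: by end_near. Qed.

Lemma exists_small_powR (K eta b r : R) : 0 <= K -> 0 < eta -> 0 < b -> 0 < r ->
  exists a, [/\ 0 < a, 2 * a <= r & K * (2 * a) `^ b <= eta].
Proof.
move=> K0 eta0 b0 r0; pose q := eta / (K + 1).
have q0 : 0 < q by rewrite divr_gt0// ltr_wpDl.
pose m := Num.min r (q `^ b^-1).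
have m0 : 0 < m by rewrite lt_min r0 powR_gt0.
exists (m / 2); rewrite divr_gt0// [2 * _]mulrC divfK//; split => //.
  by rewrite ge_min lexx.
apply: (@le_trans _ _ (K * q)).
  rewrite ler_wpM2l//; apply: (@le_trans _ _ ((q `^ b^-1) `^ b)).
    by apply: ge0_ler_powR; rewrite ?nnegrE ?(ltW b0) ?(ltW m0) ?powR_ge0// ge_min lexx orbT.
  by rewrite -powRrM mulVf ?gt_eqF// powRr1// ltW.
by rewrite /q mulrCA ler_piMr ?(ltW eta0)// ler_pdivrMr ?ltr_wpDl// mul1r lerDl.
Qed.

Lemma le_add_thirds (A B D L e : R) : A <= B + e / 3 -> B <= D + e / 3 ->
  D - e / 3 <= L -> A <= L + e.
Proof. lra. Qed.

Section limit.
Variables (g : Rn -> R) (x0 : Rn) (C r : R).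
Hypotheses (C_ge0 : 0 <= C) (r_gt0 : 0 < r) (gP : weighted_L1 g).
Hypothesis sd : forall x, `|x - x0| < r -> symdiff_bound C r g x.
Hypothesis cg : {for x0, continuous g}.

Lemma cvg_cut_fraclap_sharp : cvg (cut_fraclap (sharp eps) g x0 @[eps --> 0^'+]).
Proof.
have [C0 C00 C0P] := cut_fraclap_sharp_ramp.
apply: cauchy_cvg; apply: cauchy_exP => e e0.
have e2 : 0 < e / 2 by rewrite divr_gt0.
have s2 : 0 < 2 - 2 * s by rewrite subr_gt0 gtr_pMr.
have [a [a0 ar ae]] := exists_small_powR (mulr_ge0 C_ge0 C00) e2 s2 r_gt0.
exists (cut_fraclap (ramp a) g x0).
change (\forall eps \near 0^'+, ball (cut_fraclap (ramp a) g x0) e (cut_fraclap (sharp eps) g x0)).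
near=> eps.
rewrite -ball_normE/= distrC; apply: (@le_lt_trans _ _ (e / 2)); last first.
  by rewrite ltr_pdivrMr// ltr_pMr// ltr1n.
have eps0 : 0 < eps by near: eps; exact: nbhs_right_gt.
have epsa : eps <= a by near: eps; exact: nbhs_right_le.
have x00 : `|x0 - x0| < r by rewrite subrr normr0.
exact: le_trans (C0P C r a eps g x0 eps0 epsa ar C_ge0 gP (sd x00)) ae.
Unshelve. all: by end_near. Qed.

(** Upper semicontinuity at x0, jointly in the base point and in the truncation. *)
Lemma cut_fraclap_sharp_usc (eta : R) : 0 < eta ->
  exists2 rho, 0 < rho & exists2 eps0, 0 < eps0 & forall x eps,
    `|x - x0| < rho -> 0 < eps -> eps <= eps0 ->
    cut_fraclap (sharp eps) g x <= lim (cut_fraclap (sharp eps) g x0 @[eps --> 0^'+]) + eta.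
Proof.
move=> eta0; have [C0 C00 C0P] := cut_fraclap_sharp_ramp.
have eta3 : 0 < eta / 3 by rewrite divr_gt0.
have s2 : 0 < 2 - 2 * s by rewrite subr_gt0 gtr_pMr.
have [a [a0 ar ae]] := exists_small_powR (mulr_ge0 C_ge0 C00) eta3 s2 r_gt0.
have [rho rho0 rhoP] := cut_fraclap_ramp_continuous a0 gP cg eta3.
exists (Num.min rho r); first by rewrite lt_min rho0.
exists a => // x eps; rewrite lt_min => /andP[xrho xr] eps0 epsa.
have h1 := C0P C r a eps g x eps0 epsa ar C_ge0 gP (sd xr).
have h2 := rhoP x xrho.
have h3 : cut_fraclap (ramp a) g x0 - eta / 3 <= lim (cut_fraclap (sharp eps) g x0 @[eps --> 0^'+]).
  apply: limr_ge; first exact: cvg_cut_fraclap_sharp.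
  near=> e.
  have e0 : 0 < e by near: e; exact: nbhs_right_gt.
  have ea : e <= a by near: e; exact: nbhs_right_le.
  have x00 : `|x0 - x0| < r by rewrite subrr normr0.
  have := le_trans (C0P C r a e g x0 e0 ea ar C_ge0 gP (sd x00)) ae.
  by rewrite lerBlDr distrC => /ler_distlDr.
exact: le_add_thirds (ler_distlDr (le_trans h1 ae)) (ler_distlDr h2) h3.
Unshelve. all: by end_near. Qed.

End limit.

Lemma Rintegral_outside_ball eps g x :
  \int[leb]_(y in outside_ball x eps) ((g x - g y) * rker s (x - (y : Rn))) =
  cut_fraclap (sharp eps) g x.
Proof.
rewrite Rintegral_mkcond /cut_fraclap; apply: eq_Rintegral => y _.
rewrite patchE /cut_integrand /sharp -indic_outside_ball indicE.
by case: ifPn => _; rewrite ?mulr1 ?mulr0.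
Qed.

Lemma integrable_outside_ball eps g x : 0 < eps -> weighted_L1 g ->
  leb.-integrable (outside_ball x eps) (fun y => ((g x - g y) * rker s (x - (y : Rn)))%:E).
Proof.
move=> eps0 gP; apply/(integrable_mkcond _ (measurable_outside_ball x eps)).
have -> : (fun y : Leb => ((g x - g y) * rker s (x - (y : Rn)))%:E) \_ (outside_ball x eps) =
    EFin \o cut_integrand (sharp eps) g x.
  apply/funext => y /=; rewrite patchE /cut_integrand /sharp -indic_outside_ball indicE.
  by case: ifPn => _; rewrite ?mulr1 ?mulr0.
exact: integrable_cut_integrand (cutoff_sharp eps) gP.
Qed.

End weighted.

(** * Functions with finite interaction energy *)

Section interaction.
Variables (R : realType) (n : nat) (s : R).
Hypotheses (s_gt0 : 0 < s) (s_lt1 : s < 1).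
Notation Rn := 'rV[R]_n.+1.
Notation Leb := (lebesgue_space R n).
Notation leb := (@lebesgue_rV R n).
Implicit Types (u w : Rn -> R) (Omega : set Rn).

(** The integrand of the interaction energy. *)
Definition gagliardo w : Leb * Leb -> R := fun z =>
  `|w z.1 - w z.2| ^+ 2 * rker s ((z.1 : Rn) - (z.2 : Rn)).

Lemma gagliardo_ge0 w z : 0 <= gagliardo w z.
Proof. by rewrite mulr_ge0 ?rker_ge0// exprn_ge0. Qed.

Lemma measurable_gagliardo w : measurable_fun [set: Leb] (w : Leb -> R) ->
  measurable_fun setT (gagliardo w).
Proof.
move=> mw; apply: measurable_funM; last exact: measurable_rker_prod.
apply: measurable_funX; apply: (measurableT_comp (@normr_measurable R setT)).
by apply: measurable_funB; exact: (measurableT_comp mw).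
Qed.

Lemma measurable_Qset Omega : open Omega -> measurable (Qset Omega).
Proof.
move=> oO; apply: measurableC; apply: measurableX; apply: measurableC;
exact: measurable_open.
Qed.

Lemma interactionE Omega w :
  (interaction s Omega w = \int[leb \x leb]_(z in Qset Omega) (gagliardo w z)%:E)%E.
Proof. by []. Qed.

Lemma weighted_L1_of_interaction Omega u : open Omega -> Omega !=set0 ->
  measurable_fun [set: Leb] (u : Leb -> R) -> (interaction s Omega u < +oo)%E ->
  weighted_L1 s u.
Proof.
move=> oO O0 mu Iu; split => //.
have mQ := measurable_Qset oO.
have mO := measurable_open oO.
pose f := (EFin \o gagliardo u) \_ (Qset Omega).
have mgag : measurable_fun setT (EFin \o gagliardo u).
  by apply/measurable_EFinP; exact: measurable_gagliardo.
have mf : measurable_fun setT f.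
  by apply/(measurable_restrictT _ mQ); exact: measurable_funTS.
have f0 z : (0 <= f z)%E.
  by rewrite /f patchE; case: ifPn => // _; rewrite lee_fin gagliardo_ge0.
(* Otherwise the partial integrals are infinite on Omega, which has positive measure. *)
have [x [Ox xoo]] : exists x : Leb, Omega x /\ (\int[leb]_y (gagliardo u (x, y))%:E < +oo)%E.
  apply: contrapT => nx.
  have fx x : Omega x -> (fubini_F leb f x = +oo)%E.
    move=> Ox; apply: contrapT => /eqP fx; apply: nx; exists x; split => //.
    rewrite -ltey in fx; apply: le_lt_trans fx.
    rewrite /fubini_F le_eqVlt; apply/orP; left; apply/eqP; apply: eq_integral => y _.
    by rewrite /f patchE mem_set//= => -[].
  move: Iu; rewrite interactionE integral_mkcond -/f (fubini_tonelli1 f mf f0).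
  apply/negP; rewrite -leNgt.
  have mF : measurable_fun setT (fubini_F leb f).
    exact: (measurable_fun_fubini_tonelli_F f mf f0).
  have F0 x : (0 <= fubini_F leb f x)%E by apply: integral_ge0.
  apply: (@le_trans _ _ (\int[leb]_(x in Omega) fubini_F leb f x)%E); last first.
    exact: (ge0_subset_integral _ mO measurableT mF (fun x _ => F0 x) (@subsetT _ _)).
  rewrite (eq_integral (cst +oo%E)); last by move=> x; rewrite inE => /fx.
  by rewrite (integral_cst _ mO) gt0_mulye//; exact: leb_open_gt0.
have [C C0 CP] := wgt_le_rker n s_gt0 (normr_ge0 (x : Rn)).
have ix : leb.-integrable setT (EFin \o (fun y : Leb => gagliardo u (x, y))).
  apply/integrableP; split.
    apply/measurable_EFinP; apply: (measurableT_comp (measurable_gagliardo mu)).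
    exact: pair1_measurable.
  apply: le_lt_trans xoo; rewrite le_eqVlt; apply/orP; left; apply/eqP.
  by apply: eq_integral => y _ /=; rewrite ger0_norm// gagliardo_ge0.
apply: (integrable_dominated (g := fun y : Leb =>
   (`|u x| + 1) * wgt s (y : Rn) + C * gagliardo u (x, y))).
- exact: (measurable_funM mu (@measurable_wgt R n s)).
- move=> y; have w0 := ltW (wgt_gt0 s (y : Rn)).
  rewrite normrM (ger0_norm w0).
  have [xy|xy] := eqVneq (x : Rn) (y : Rn).
    apply: (@le_trans _ _ ((`|u x| + 1) * wgt s (y : Rn))).
      by rewrite ler_wpM2r// xy lerDl.
    by rewrite lerDl mulr_ge0// gagliardo_ge0.
  have uy : `|u y| <= `|u x| + 1 + `|u x - u y| ^+ 2.
    have h : `|u y| <= `|u x| + `|u x - u y|.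
      by rewrite -{1}[u y](subrK (u x)) addrC (le_trans (ler_normD _ _))// lerD2l distrC.
    apply: le_trans h _; rewrite -addrA lerD2l.
    by set t := `|_|; have := sqr_ge0 (t - 1); nra.
  apply: le_trans (ler_wpM2r w0 uy) _; rewrite mulrDl lerD2l.
  rewrite /gagliardo/= mulrCA ler_wpM2l ?exprn_ge0//.
  exact: CP.
- apply: integrable_add; apply: integrable_scale => //.
  exact: integrable_wgt.
Qed.

Lemma L1_s_of_weighted_L1 u : weighted_L1 s u -> L1_s s u.
Proof.
move=> [mu iu]; have iau := integrable_abs iu.
split=> [K cK|]; last first.
  move/integrableP: iu => [_]; apply: le_lt_trans.
  rewrite le_eqVlt; apply/orP; left; apply/eqP; apply: eq_integral => y _ /=.
  by rewrite normrM (ger0_norm (ltW (wgt_gt0 _ _))).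
have clK : closed K by apply: compact_closed => //; exact: norm_hausdorff.
have mK := measurable_closed clK.
have [M KM] : exists M, forall y, K y -> `|y| <= M.
  have [M [_ /(_ (M + 1))]] := compact_bounded cK; rewrite ltrDl ltr01 => /(_ isT) KM.
  by exists (M + 1).
pose B := (n.+1%:R * Num.max 0 M) `^ (n.+1%:R + 2 * s).
have KB y : K y -> kernel_power s y <= B.
  move=> Ky; apply: ge0_ler_powR.
  - by rewrite ltW// exponent_gt0.
  - by rewrite nnegrE enorm_ge0.
  - by rewrite nnegrE mulr_ge0// le_max lexx.
  - apply: le_trans (enorm_le_norm y) _; rewrite ler_wpM2l//.
    by rewrite le_max KM// orbT.
apply: (le_integrable mK (g := EFin \o (fun y : Leb => (1 + B) * `|u y * wgt s (y : Rn)|))).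
- by apply/measurable_EFinP; exact: measurable_funTS.
- move=> y Ky /=; rewrite lee_fin.
  have w0 := wgt_gt0 s (y : Rn); have k0 := kernel_power_ge0 s (y : Rn).
  rewrite [leRHS]ger0_norm; last by rewrite mulr_ge0// addr_ge0// powR_ge0.
  rewrite normrM (ger0_norm (ltW w0)) mulrCA -[leLHS]mulr1 ler_wpM2l//.
  rewrite -[leLHS](@mulVf _ (wgt s (y : Rn))) ?gt_eqF// ler_wpM2r ?(ltW w0)// /wgt invrK lerD2l.
  exact: KB.
- apply: (integrableS measurableT mK (@subsetT _ _)).
  exact: integrable_scale.
Qed.

End interaction.

(** * The competitor max(u, Phi) *)

(** Here ux + wx is max(ux, px), and likewise for y. *)
Lemma gagliardo_max_le (R : realType) (ux uy px py : R) :
  let wx := Num.max 0 (px - ux) in let wy := Num.max 0 (py - uy) in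
  `|(ux + wx) - (uy + wy)| ^+ 2 <= `|ux - uy| ^+ 2 + 2 * ((wx - wy) * (px - py)).
Proof.
rewrite /= !real_normK ?num_real//.
have [hx|hx] := leP (px - ux) 0; have [hy|hy] := leP (py - uy) 0.
- by rewrite !addr0 subrr mul0r mulr0 addr0.
- have h : 0 <= (py - uy) * (ux - px) by rewrite mulr_ge0 ?(ltW hy)// -opprB oppr_ge0.
  have := sqr_ge0 (py - uy); nra.
- have h : 0 <= (px - ux) * (uy - py) by rewrite mulr_ge0 ?(ltW hx)// -opprB oppr_ge0.
  have := sqr_ge0 (px - ux); nra.
- have := sqr_ge0 ((px - ux) - (py - uy)); nra.
Qed.

Section competitor.
Variables (R : realType) (n : nat) (s : R).
Hypotheses (s_gt0 : 0 < s) (s_lt1 : s < 1).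
Notation Rn := 'rV[R]_n.+1.
Notation Leb := (lebesgue_space R n).
Notation leb := (@lebesgue_rV R n).
Variables (Omega : set Rn) (u Phi : Rn -> R) (x0 : Rn) (rho delta M : R).
Hypotheses (Omega_open : open Omega) (u_wint : weighted_L1 s u) (Phi_wint : weighted_L1 s Phi).
Hypotheses (rho_ge0 : 0 <= rho) (cube_Omega : cube x0 rho `<=` Omega).
Hypothesis Phi_le_out : forall y, ~ cube x0 rho y -> Phi y <= u y.
Hypothesis Phi_le_in : forall y, Phi y <= u y + delta.
Hypothesis Phi_bounded : forall y, cube x0 rho y -> `|Phi y| <= M.
Hypothesis delta_ge0 : 0 <= delta.

(** What must be added to u to obtain max(u, Phi). *)
Definition excess u Phi (y : Rn) : R := Num.max 0 (Phi y - u y).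
Let w := excess u Phi.
Let v y := u y + w y.

Lemma excess_ge0 y : 0 <= w y. Proof. by rewrite le_max lexx. Qed.

Lemma excess_le y : w y <= delta.
Proof. by rewrite ge_max delta_ge0/= lerBlDl Phi_le_in. Qed.

Lemma excess_out y : ~ cube x0 rho y -> w y = 0.
Proof. by move=> yout; rewrite /w /excess max_l// subr_le0 Phi_le_out. Qed.

Lemma measurable_excess : measurable_fun [set: Leb] (w : Leb -> R).
Proof.
have [mu _] := u_wint; have [mPhi _] := Phi_wint.
apply: measurable_maxr; first exact: measurable_cst.
exact: measurable_funB.
Qed.

Lemma integrable_excess : leb.-integrable setT (EFin \o (w : Leb -> R)).
Proof.
apply: (integrable_dominated (g := fun y : Leb => delta * \1_(cube x0 rho) y)).
- exact: measurable_excess.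
- move=> y; rewrite (ger0_norm (excess_ge0 y)) indicE.
  have [yc|/negP] := boolP (y \in cube x0 rho); first by rewrite mulr1 excess_le.
  by rewrite inE => /excess_out ->; rewrite mulr0.
- apply: integrable_scale; exact: integrable_indic_cube.
Qed.

Let W : R := \int[leb]_y w y.

(** Half of the truncated cross term 2 (w x - w y) (Phi x - Phi y) K(x - y) is the sum of
    this function and of its transpose. *)
Definition cross eps : Leb * Leb -> R := fun z => w z.1 * cut_integrand s (sharp eps) Phi z.1 z.2.

Lemma measurable_cross eps : measurable_fun setT (cross eps).
Proof.
have [mPhi _] := Phi_wint; have [mt _ _] := cutoff_sharp eps.
apply: measurable_funM; first exact: (measurableT_comp measurable_excess).
apply: measurable_funM; last exact: (measurableT_comp mt (@measurable_enorm_prod R n)).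
apply: measurable_funM; last exact: measurable_rker_prod.
by apply: measurable_funB; exact: (measurableT_comp mPhi).
Qed.

Let M_ge0 : 0 <= M.
Proof.
have x0c : cube x0 rho x0 by rewrite /cube/= subrr normr0.
exact: le_trans (normr_ge0 _) (Phi_bounded x0c).
Qed.

Lemma cross_double_lty eps : 0 < eps ->
  (\int[leb]_x \int[leb]_y `|(cross eps (x, y))%:E| < +oo)%E.
Proof.
move=> eps0; have M0 := M_ge0.
have [C C0 CP] := cut_integrand_le_majorant n s_gt0 (addr_ge0 (normr_ge0 x0) rho_ge0) eps0.
have iD := integrable_majorant s_gt0 M C Phi_wint.
have D0 y : 0 <= majorant s M C Phi y by exact: majorant_ge0.
set D := (\int[leb]_y (majorant s M C Phi y)%:E)%E.
have Dfin : D \is a fin_num by exact: (integrable_fin_num measurableT iD).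
have D0' : (0 <= D)%E by apply: integral_ge0 => y _; rewrite lee_fin.
have mdom : measurable_fun setT (EFin \o majorant s M C Phi) := measurable_int _ iD.
have mcross : measurable_fun setT (fun z : Leb * Leb => `|(cross eps z)%:E|%E).
  by apply: measurableT_comp => //; apply/measurable_EFinP; exact: measurable_cross.
have inner (x : Leb) : (\int[leb]_y `|(cross eps (x, y))%:E| <=
    (delta * \1_(cube x0 rho) x)%:E * D)%E.
  have k0 : 0 <= delta * \1_(cube x0 rho) x by rewrite mulr_ge0// indicE.
  rewrite -(ge0_integralZl_EFin _ measurableT _ mdom k0); last first.
    by move=> y _; rewrite lee_fin; exact: D0.
  apply: (ge0_le_integral _ measurableT).
  - by move=> y _; exact: abse_ge0.
  - exact: (measurableT_comp mcross (pair1_measurable x)).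
  - exact: measurable_funeM.
  - move=> y _ /=; rewrite -EFinM lee_fin /cross/= normrM (ger0_norm (excess_ge0 x)).
    rewrite indicE; have [xc|/negP] := boolP (x \in cube x0 rho); last first.
      by rewrite inE => /excess_out ->; rewrite mulr0 !mul0r.
    rewrite mulr1; apply: ler_pM; rewrite ?excess_ge0 ?excess_le//.
    move: xc; rewrite inE => xc; apply: CP => //.
    + exact: cutoff_sharp.
    + have -> : x = x0 - (x0 - (x : Rn)) :> Rn by rewrite opprB addrC subrK.
      by apply: le_trans (ler_normB _ _) _; rewrite lerD2l.
    + exact: Phi_bounded.
have mcube : measurable (cube x0 rho : set Leb) by exact: measurable_cube.
apply: (@le_lt_trans _ _ (\int[leb]_x ((delta * fine D) * \1_(cube x0 rho) x)%:E)%E); last first.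
  have h := integrable_scale (delta * fine D) (integrable_indic_cube x0 rho_ge0).
  exact: (integrable_lty measurableT h).
apply: (ge0_le_integral _ measurableT).
- by move=> x _; apply: integral_ge0 => y _; exact: abse_ge0.
- exact: (measurable_fun_fubini_tonelli_F _ mcross (fun z => abse_ge0 _)).
- apply/measurable_EFinP; apply: measurable_funM; first exact: measurable_cst.
  exact: measurable_indic.
- move=> x _; apply: le_trans (inner x) _.
  by rewrite -{1}(fineK Dfin) -EFinM mulrAC.
Qed.

Lemma integrable_cross eps : 0 < eps ->
  (leb \x leb)%E.-integrable setT (EFin \o cross eps).
Proof.
move=> eps0.
have mc : measurable_fun setT (EFin \o cross eps).
  by apply/measurable_EFinP; exact: measurable_cross.
exact: (integrable12ltyP leb leb mc).2 (cross_double_lty eps0).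
Qed.

Lemma integrable_cross_swap eps : 0 < eps ->
  (leb \x leb)%E.-integrable setT (EFin \o (fun z => cross eps (z.2, z.1))).
Proof.
move=> eps0.
have mc : measurable_fun setT (EFin \o (fun z : Leb * Leb => cross eps (z.2, z.1))).
  apply/measurable_EFinP.
  exact: (measurableT_comp (measurable_cross eps) (@measurable_swap _ _ Leb Leb)).
exact: (integrable21ltyP leb leb mc).2 (cross_double_lty eps0).
Qed.

Lemma integral_cross_swap eps : 0 < eps ->
  (\int[leb \x leb]_z (cross eps (z.2, z.1))%:E = \int[leb \x leb]_z (cross eps z)%:E)%E.
Proof.
move=> eps0.
rewrite -(integral12_prod_meas1 (integrable_cross eps0)).
by rewrite -(integral21_prod_meas1 (integrable_cross_swap eps0)).
Qed.

(** The inner integral of cross is w x times the truncated operator of Phi at x. *)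
Lemma integral_cross_le eps Lam : 0 < eps ->
  (forall x, cube x0 rho x -> cut_fraclap s (sharp eps) Phi x <= Lam) ->
  (\int[leb \x leb]_z (cross eps z)%:E <= (Lam * W)%:E)%E.
Proof.
move=> eps0 opLam; have ic := integrable_cross eps0.
have fubE x : fubini_F leb (EFin \o cross eps) x = (w x * cut_fraclap s (sharp eps) Phi x)%:E.
  have iw := integrable_cut_integrand s_gt0 x eps0 (cutoff_sharp eps) Phi_wint.
  rewrite /fubini_F EFinM /cut_fraclap /Rintegral fineK; last first.
    exact: (integrable_fin_num measurableT iw).
  by rewrite -(integralZl measurableT iw).
have iF := integrable_fubini_F ic.
rewrite -(integral12_prod_meas1 ic).
have -> : (Lam * W)%:E = (\int[leb]_x (Lam * w x)%:E)%E.
  rewrite EFinM /W /Rintegral fineK; last exact: (integrable_fin_num measurableT integrable_excess).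
  by rewrite -(integralZl measurableT integrable_excess).
apply: (le_integral measurableT iF (integrable_scale Lam integrable_excess)) => x _.
rewrite fubE lee_fin [leRHS]mulrC.
have [xc|xc] := pselect (cube x0 rho x); last by rewrite excess_out// !mul0r.
by rewrite ler_wpM2l ?excess_ge0//; exact: opLam.
Qed.

Lemma measurable_competitor : measurable_fun [set: Leb] (v : Leb -> R).
Proof. by have [mu _] := u_wint; apply: measurable_funD mu measurable_excess. Qed.

Lemma gagliardo_competitor_le eps z :
  gagliardo s v z * sharp eps (enorm ((z.1 : Rn) - (z.2 : Rn))) <=
  gagliardo s u z + 2 * (cross eps z + cross eps (z.2, z.1)).
Proof.
case: z => x y; rewrite /gagliardo /cross /cut_integrand/=.
rewrite -[(y : Rn) - x]opprB rkerN enormN /sharp.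
have K0 := rker_ge0 s ((x : Rn) - y); set K := rker _ _ in K0 *.
case: (eps <= _); rewrite /= ?mulr1n ?mulr0n; last first.
  by rewrite !mulr0 !addr0 mulr0 addr0 mulr_ge0// exprn_ge0.
rewrite !mulr1; have h := gagliardo_max_le (u x) (u y) (Phi x) (Phi y).
have := ler_wpM2r K0 h; move/le_trans; apply.
rewrite le_eqVlt; apply/orP; left; apply/eqP.
rewrite /w /excess; ring.
Qed.

Lemma truncated_interaction_le eps Lam : 0 < eps ->
  (forall x, cube x0 rho x -> cut_fraclap s (sharp eps) Phi x <= Lam) ->
  (interaction s Omega u < +oo)%E ->
  (\int[leb \x leb]_(z in Qset Omega)
     (gagliardo s v z * sharp eps (enorm ((z.1 : Rn) - (z.2 : Rn))))%:E <=
   interaction s Omega u + (4 * Lam * W)%:E)%E.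
Proof.
move=> eps0 opLam Iu; have mQ := measurable_Qset Omega_open.
have [mu _] := u_wint.
pose G (z : Leb * Leb) := 2 * (cross eps z + cross eps (z.2, z.1)).
have iG : (leb \x leb)%E.-integrable setT (EFin \o G).
  apply: integrable_scale.
  exact: (integrable_add (integrable_cross eps0) (integrable_cross_swap eps0)).
have iGQ : (leb \x leb)%E.-integrable (Qset Omega) (EFin \o G).
  exact: (integrableS measurableT mQ (@subsetT _ _) iG).
have mgu : measurable_fun (Qset Omega) (EFin \o gagliardo s u).
  by apply/measurable_EFinP; apply: measurable_funTS; exact: measurable_gagliardo.
have iu : (leb \x leb)%E.-integrable (Qset Omega) (EFin \o gagliardo s u).
  apply/integrableP; split=> //.
  rewrite (eq_integral (EFin \o gagliardo s u)); first exact: Iu.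
  by move=> z _ /=; rewrite ger0_norm// gagliardo_ge0.
have [mt _ t0] := cutoff_sharp eps.
have mlhs : measurable_fun (Qset Omega) (fun z : Leb * Leb =>
    (gagliardo s v z * sharp eps (enorm ((z.1 : Rn) - (z.2 : Rn))))%:E).
  apply/measurable_EFinP; apply: measurable_funTS; apply: measurable_funM.
    exact: measurable_gagliardo measurable_competitor.
  exact: (measurableT_comp mt (@measurable_enorm_prod R n)).
apply: (@le_trans _ _ (\int[leb \x leb]_(z in Qset Omega) ((gagliardo s u z)%:E + (G z)%:E))%E).
  apply: (ge0_le_integral _ mQ).
  - by move=> z _; rewrite lee_fin mulr_ge0 ?gagliardo_ge0// /sharp ler0n.
  - exact: mlhs.
  - apply: emeasurable_funD; first exact: mgu.
    exact: measurable_int iGQ.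
  - by move=> z _; rewrite -EFinD lee_fin; exact: gagliardo_competitor_le.
rewrite (integralD mQ iu iGQ) interactionE leeD2l//.
(* The cross term vanishes outside Q(Omega), since w vanishes outside Omega. *)
have -> : (\int[leb \x leb]_(z in Qset Omega) (EFin \o G) z = \int[leb \x leb]_z (EFin \o G) z)%E.
  rewrite integral_mkcond; apply: eq_integral => z _; rewrite patchE.
  case: ifPn => // /negP; rewrite inE => /contrapT [/= z1 z2].
  rewrite /G /cross/= !excess_out ?mul0r ?addr0 ?mulr0//.
  - by move/cube_Omega.
  - by move/cube_Omega.
rewrite (integralZl measurableT
  (f := EFin \o (fun z => cross eps z + cross eps (z.2, z.1)))); last first.
  exact: (integrable_add (integrable_cross eps0) (integrable_cross_swap eps0)).
rewrite (integralD measurableT (integrable_cross eps0) (integrable_cross_swap eps0)).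
rewrite [X in (_ * (_ + X) <= _)%E](integral_cross_swap eps0).
have h := integral_cross_le eps0 opLam.
have fin : (\int[leb \x leb]_z (EFin \o cross eps) z)%E \is a fin_num.
  exact: (integrable_fin_num measurableT (integrable_cross eps0)).
move: h; rewrite -[X in (X <= _)%E -> _](fineK fin) lee_fin => h.
rewrite -[X in (_ * (X + X) <= _)%E](fineK fin) -EFinD -EFinM lee_fin; lra.
Qed.

(** The truncation is removed by monotone convergence; the diagonal does not matter, as
    the kernel is 0 there. *)
Lemma interaction_competitor_le eps0 Lam : 0 < eps0 ->
  (forall eps x, 0 < eps -> eps <= eps0 -> cube x0 rho x ->
    cut_fraclap s (sharp eps) Phi x <= Lam) ->
  (interaction s Omega u < +oo)%E ->
  (interaction s Omega v <= interaction s Omega u + (4 * Lam * W)%:E)%E.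
Proof.
move=> eps00 opLam Iu; have mQ := measurable_Qset Omega_open.
pose e (k : nat) := eps0 / k.+1%:R.
have e0 k : 0 < e k by rewrite divr_gt0.
have ee k : e k <= eps0 by rewrite ler_pdivrMr// ler_peMr ?(ltW eps00)// ler1n.
pose f k (z : Leb * Leb) := (gagliardo s v z * sharp (e k) (enorm ((z.1 : Rn) - (z.2 : Rn))))%:E.
have mf k : measurable_fun (Qset Omega) (f k).
  have [mt _ _] := cutoff_sharp (e k).
  apply/measurable_EFinP; apply: measurable_funTS; apply: measurable_funM.
    exact: measurable_gagliardo measurable_competitor.
  exact: (measurableT_comp mt (@measurable_enorm_prod R n)).
have f0 k z : Qset Omega z -> (0 <= f k z)%E.
  by move=> _; rewrite lee_fin mulr_ge0 ?gagliardo_ge0// /sharp ler0n.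
have nd z : Qset Omega z -> {homo f^~ z : k m / (k <= m)%N >-> (k <= m)%E}.
  move=> _ k m km; rewrite lee_fin ler_wpM2l ?gagliardo_ge0// /sharp ler_nat.
  case: (leP (e k) _) => // ek; rewrite (le_trans _ ek)//.
  by rewrite ler_pM2l// lef_pV2 ?posrE// ler_nat.
have flim z : limn (f^~ z) = (gagliardo s v z)%:E.
  apply: cvg_lim => //.
  have [z12|] := eqVneq ((z.1 : Rn) - (z.2 : Rn)) 0.
    have gz : gagliardo s v z = 0 by rewrite /gagliardo z12 rker0// mulr0.
    by rewrite gz; under eq_fun do rewrite /f gz mul0r; exact: cvg_cst.
  rewrite -enorm_gt0 => z12.
  apply: cvg_near_cst; near=> k; rewrite /f /sharp.
  suff -> : e k <= enorm ((z.1 : Rn) - (z.2 : Rn)) by rewrite mulr1.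
  rewrite /e mulrC -ler_pdivlMr//; apply: ltW.
  near: k; apply: (near_infty_natSinv_lt (PosNum (divr_gt0 z12 eps00))).
have -> : interaction s Omega v = (\int[leb \x leb]_(z in Qset Omega) limn (f^~ z))%E.
  by rewrite interactionE; apply: eq_integral => z _; rewrite flim.
rewrite (monotone_convergence _ mQ mf f0 nd).
apply: lime_le.
  apply: ereal_nondecreasing_is_cvgn => k m km.
  by apply: (ge0_le_integral _ mQ (f0 k) (mf k) (mf m)) => z Qz; exact: nd.
near=> k.
by apply: truncated_interaction_le => // x xc; apply: opLam.
Unshelve. all: by end_near. Qed.

End competitor.

(** * Comparison of energies *)

(** The integral is the difference of the integrals of the positive and negative parts,
    and a difference of extended reals is finite only if both terms are. *)
Lemma fin_num_integral_integrable d (T : measurableType d) (R : realType)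
    (mu : {measure set T -> \bar R}) (D : set T) (f : T -> \bar R) :
  measurable D -> measurable_fun D f -> (\int[mu]_(x in D) f x)%E \is a fin_num ->
  mu.-integrable D f.
Proof.
move=> mD mf; rewrite integralE fin_numB => /andP[fp fm].
apply/integrableP; split => //.
rewrite -[fun x => _]/(abse \o f) fune_abse.
rewrite ge0_integralD//.
- by rewrite ltey_eq fin_numD fp fm.
- exact: measurable_funepos.
- exact: measurable_funeneg.
Qed.

Section energy.
Variables (R : realType) (n : nat) (s : R).
Hypotheses (s_gt0 : 0 < s) (s_lt1 : s < 1).
Notation Rn := 'rV[R]_n.+1.
Notation Leb := (lebesgue_space R n).
Notation leb := (@lebesgue_rV R n).

Lemma interaction_ge0 Omega (w : Rn -> R) : (0 <= interaction s Omega w)%E.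
Proof. by rewrite interactionE; apply: integral_ge0 => z _; rewrite lee_fin gagliardo_ge0. Qed.

Lemma energy_fin_num (c : R) (F : R -> R) Omega (u : Rn -> R) : 0 < c ->
  energy c s F Omega u \is a fin_num ->
  interaction s Omega u \is a fin_num /\ potential F Omega u \is a fin_num.
Proof.
move=> c0; rewrite /energy fin_numB => /andP[hI hP]; split => //.
rewrite ge0_fin_numE ?interaction_ge0//.
rewrite ltey; apply: contraTneq hI => ->.
by rewrite gt0_muley// lte_fin divr_gt0.
Qed.

(** Let Phi <= u outside a cube in Omega. If on this cube the truncated operators of Phi
    are at most (L - 2 eta) / c, and F increases from u to max(u, Phi) at rate at least
    L - eta, then max(u, Phi) has less energy than u, contradicting minimality. *)
Lemma energy_decrease (c : R) (F : R -> R) (Omega : set Rn) (u Phi : Rn -> R) (x0 : Rn)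
    (rho delta M eps0 L eta B : R) :
  0 < c -> open Omega -> minimizer_by_above c s F Omega u -> measurable_fun setT F ->
  weighted_L1 s u -> weighted_L1 s Phi -> 0 <= rho -> cube x0 rho `<=` Omega ->
  (forall y, ~ cube x0 rho y -> Phi y <= u y) ->
  0 <= delta -> (forall y, Phi y <= u y + delta) ->
  (forall y, cube x0 rho y -> `|Phi y| <= M) ->
  (forall y, cube x0 rho y ->
    (L - eta) * excess u Phi y <= F (u y + excess u Phi y) - F (u y) /\
    `|F (u y + excess u Phi y) - F (u y)| <= B * excess u Phi y) ->
  0 < eps0 -> (forall eps x, 0 < eps -> eps <= eps0 -> cube x0 rho x ->
    c * cut_fraclap s (sharp eps) Phi x <= L - 2 * eta) ->
  0 < eta -> 0 < \int[leb]_y (excess u Phi : Leb -> R) y -> False.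
Proof.
move=> c0 oO [[mu _ _] Efin umin] mF uw Pw rho0 cO Pout delta0 Pin PM dF eps00 opL eta0 W0.
have [Ifin Pfin] := energy_fin_num c0 Efin.
have mO := measurable_open oO.
set w := excess u Phi in W0 dF *; set W := \int[leb]_y _ in W0.
pose v y := u y + w y.
have w0 y : 0 <= w y := excess_ge0 u Phi y.
have wout y : ~ cube x0 rho y -> w y = 0 by move=> yout; exact: (excess_out Pout yout).
have mv : measurable_fun [set: Leb] (v : Leb -> R) := measurable_competitor uw Pw.
have iw : leb.-integrable setT (EFin \o (w : Leb -> R)).
  exact: integrable_excess uw Pw rho0 Pout Pin delta0.
have iFu : leb.-integrable Omega (EFin \o (fun y : Leb => F (u y))).
  apply: fin_num_integral_integrable => //.
  by apply/measurable_EFinP; apply: measurable_funTS; exact: (measurableT_comp mF mu).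
pose d (y : Leb) := F (v y) - F (u y).
have md : measurable_fun setT d.
  by apply: measurable_funB; [exact: (measurableT_comp mF mv)|exact: (measurableT_comp mF mu)].
have dout y : ~ cube x0 rho y -> d y = 0.
  by move=> yout; rewrite /d /v wout// addr0 subrr.
have id : leb.-integrable setT (EFin \o d).
  apply: (integrable_dominated (g := fun y : Leb => B * w y)) => //.
  - move=> y; have [yc|yc] := pselect (cube x0 rho y); first by have [] := dF y yc.
    by rewrite dout// normr0 wout// mulr0.
  - exact: integrable_scale.
have idO := integrableS measurableT mO (@subsetT _ _) id.
have Fv : (fun y : Leb => F (v y)) = (fun y : Leb => F (u y) + d y).
  by apply/funext => y; rewrite /d addrC subrK.
have iFv : leb.-integrable Omega (EFin \o (fun y : Leb => F (v y))).
  rewrite Fv; exact: (integrableD mO iFu idO).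
have dO : (\int[leb]_(y in Omega) (d y)%:E = \int[leb]_y (d y)%:E)%E.
  rewrite integral_mkcond; apply: eq_integral => y _; rewrite patchE.
  case: ifPn => // /negP; rewrite inE => yO; rewrite dout// => /cO.
  exact: yO.
have dfin : (\int[leb]_y (d y)%:E)%E \is a fin_num by exact: (integrable_fin_num measurableT id).
set D := fine (\int[leb]_y (d y)%:E)%E.
have potv : potential F Omega v = (potential F Omega u + D%:E)%E.
  rewrite /potential /D fineK// -dO -(integralD mO iFu idO).
  by apply: eq_integral => y _; rewrite -EFinD -[F (v y)]/((fun y => F (v y)) y) Fv.
have DW : (L - eta) * W <= D.
  rewrite -lee_fin fineK// /W EFinM /Rintegral fineK; last first.
    exact: (integrable_fin_num measurableT iw).
  rewrite -(integralZl measurableT iw).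
  apply: (le_integral measurableT (integrable_scale (L - eta) iw) id) => y _ /=.
  rewrite lee_fin; have [yc|yc] := pselect (cube x0 rho y); first by have [] := dF y yc.
  by rewrite dout// wout// mulr0.
have Iv : (interaction s Omega v <= interaction s Omega u + (4 * ((L - 2 * eta) / c) * W)%:E)%E.
  apply: (interaction_competitor_le s_gt0 oO uw Pw rho0 cO Pout Pin PM delta0 eps00).
    by move=> eps x e0 ee xc; rewrite ler_pdivlMr// mulrC; exact: opL.
  by rewrite ltey_eq Ifin.
have Pvfin : potential F Omega v \is a fin_num by rewrite potv fin_numD Pfin.
have vdef : energy_defined c s F Omega v.
  split; [exact: mv| |].
    exact: (integrable_add_def mO iFv).
  by apply: fin_num_adde_defl; rewrite fin_numN.
have uv y : Omega y -> u y <= v y by rewrite lerDl.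
have vu y : ~ Omega y -> v y = u y.
  by move=> yO; rewrite /v wout ?addr0// => /cO.
have := umin v vdef uv vu.
have Ivfin : interaction s Omega v \is a fin_num.
  rewrite ge0_fin_numE ?interaction_ge0//; apply: le_lt_trans Iv _.
  by rewrite -(fineK Ifin) -EFinD ltry.
move: Iv; rewrite /energy potv -(fineK Ifin) -(fineK Pfin) -(fineK Ivfin).
move: (fine _) (fine _) (fine _) => iu pu iv.
rewrite -EFinD lee_fin => Iv; rewrite -EFinD -!EFinM -!EFinN -!EFinD lee_fin.
apply/negP; rewrite -ltNge.
have c4 : 0 <= c / 4 by rewrite divr_ge0// ltW.
have := ler_wpM2l c4 Iv; rewrite mulrDr.
have -> : c / 4 * (4 * ((L - 2 * eta) / c) * W) = (L - 2 * eta) * W by field; rewrite gt_eqF.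
have := mulr_gt0 eta0 W0.
nra.
Qed.

(** Raising g by delta on a ball increases its truncated operators, at the points of a
    smaller cube, by at most delta times a tail of the kernel. *)
Lemma cut_fraclap_add_indic_le (g : Rn -> R) (x0 : Rn) (rho : R) : 0 < rho -> weighted_L1 s g ->
  exists2 CT, 0 <= CT & forall delta x eps, 0 <= delta -> cube x0 rho x -> 0 < eps ->
    weighted_L1 s (fun y => g y + delta * \1_[set y | `|x0 - y| < 2 * rho] y) ->
    cut_fraclap s (sharp eps) (fun y => g y + delta * \1_[set y | `|x0 - y| < 2 * rho] y) x <=
    cut_fraclap s (sharp eps) g x + delta * CT.
Proof.
move=> rho0 gw; have [CT CT0 CTP] := integral_tail n s_gt0 rho0.
exists CT => // delta x eps delta0 xc eps0.
set Phi := (fun y => _); move=> Pw.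
have ig := integrable_cut_integrand s_gt0 x eps0 (cutoff_sharp eps) gw.
have iP := integrable_cut_integrand s_gt0 x eps0 (cutoff_sharp eps) Pw.
have it := integrable_scale delta (integrable_indic_outside_ball_rker s_gt0 x rho0).
have tfin := integrable_fin_num measurableT (integrable_indic_outside_ball_rker s_gt0 x rho0).
apply: (@le_trans _ _ (\int[leb]_y (cut_integrand s (sharp eps) g x y +
    delta * (\1_(outside_ball x rho) y * rker s (x - (y : Rn)))))).
  apply: (le_Rintegral measurableT iP (integrable_add ig it)) => y _.
  rewrite /cut_integrand /Phi /sharp.
  have xB : x \in [set y | `|x0 - y| < 2 * rho].
    by rewrite inE/= (le_lt_trans xc)// mulr2n mulrDl mul1r ltrDl.
  rewrite !indicE xB mulr1.
  have K0 := rker_ge0 s (x - (y : Rn)).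
  have [yB|/negP yB] := boolP ((y : Rn) \in [set y | `|x0 - y| < 2 * rho]).
    rewrite mulr1 [X in _ <= X + _](_ : _ = (g x + delta - (g y + delta)) * rker s (x - (y : Rn)) *
      (eps <= enorm (x - (y : Rn)))%R%:R); last by ring.
    by rewrite lerDl mulr_ge0// mulr_ge0.
  rewrite mulr0 addr0 mem_set; last first.
    rewrite /outside_ball/=; apply: le_trans (norm_le_enorm _).
    rewrite leNgt; apply/negP => xy; apply: yB; rewrite inE/=.
    have -> : x0 - (y : Rn) = (x0 - x) + (x - (y : Rn)) by rewrite addrA subrK.
    apply: le_lt_trans (ler_normD _ _) _; rewrite mulrDl mul1r.
    exact: ler_ltD.
  rewrite mul1r; case: (eps <= _); rewrite /= ?mulr1n ?mulr0n.
    by rewrite !mulr1 -mulrDl addrAC.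
  by rewrite !mulr0 add0r mulr_ge0.
rewrite (RintegralD measurableT ig it) lerD2l.
rewrite (RintegralZl _ measurableT (integrable_indic_outside_ball_rker s_gt0 x rho0)) ler_wpM2l//.
rewrite -lee_fin /Rintegral fineK//; apply: le_trans (CTP x).
rewrite [leRHS]integral_mkcond le_eqVlt; apply/orP; left; apply/eqP.
apply: eq_integral => y _ /=; rewrite patchE indicE.
by case: ifPn => _; rewrite ?mul1r ?mul0r.
Qed.

Lemma Rintegral_gt0_cube (f : Rn -> R) (x0 : Rn) (r a : R) : 0 < r -> 0 < a ->
  leb.-integrable setT (EFin \o (f : Leb -> R)) -> (forall y, 0 <= f y) ->
  (forall y, cube x0 r y -> a <= f y) -> 0 < \int[leb]_y (f : Leb -> R) y.
Proof.
move=> r0 a0 fi f0 fa; have ic := integrable_indic_cube x0 (ltW r0).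
have mc : measurable (cube x0 r : set Leb) by apply: measurable_cube; exact: ltW.
apply: (@lt_le_trans _ _ (\int[leb]_y (a * \1_(cube x0 r) y))).
  rewrite (RintegralZl _ measurableT ic) mulr_gt0// /Rintegral.
  rewrite (integral_indic _ measurableT mc) setIT [X in 0 < fine X]leb_cube ?(ltW r0)//=.
  by rewrite exprn_gt0// mulr_gt0.
apply: (le_Rintegral measurableT (integrable_scale a ic) fi) => y _.
rewrite indicE; have [/set_mem yc|_] := boolP (y \in cube x0 r).
  by rewrite mulr1 fa.
by rewrite mulr0.
Qed.

End energy.

(** * The lifted test function *)

Section patched.
Variables (R : realType) (n : nat) (s : R).
Hypotheses (s_gt0 : 0 < s) (s_lt1 : s < 1).
Notation Rn := 'rV[R]_n.+1.
Notation Leb := (lebesgue_space R n).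
Notation leb := (@lebesgue_rV R n).
Implicit Types (N U : set Rn) (u phi g : Rn -> R).

Lemma patch_in u N phi y : N y -> patch u N phi y = phi y.
Proof. by move=> Ny; rewrite /patch mem_set. Qed.

Lemma patch_out u N phi y : ~ N y -> patch u N phi y = u y.
Proof. by move=> Ny; rewrite /patch memNset. Qed.

Lemma compact_closure_bounded N : bounded_set N -> compact (closure N).
Proof.
move=> [M [_ NM]]; apply: bounded_closed_compact; last exact: closed_closure.
have NB : closure N `<=` [set y | `|y| <= M + 1].
  have cB : closed [set y : Rn | `|y| <= M + 1].
    rewrite (_ : [set y : Rn | _] = (fun y : Rn => `|y|) @^-1` [set t | t <= M + 1])//.
    by apply: closed_comp => [y _|]; [exact: norm_continuous|exact: closed_le].
  rewrite [X in _ `<=` X](closure_id _).1//; apply: closure_subset => y Ny.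
  by apply: NM Ny; rewrite ltrDl.
exists (M + 1); split; first exact: num_real.
by move=> x Mx y /NB yM; exact: le_trans yM (ltW Mx).
Qed.

(** A C^1 function on a neighborhood of the closure of a bounded set is bounded on it. *)
Lemma C1_on_bounded N U phi : bounded_set N -> open U -> closure N `<=` U -> C1_on U phi ->
  exists2 M, 0 <= M & forall y, N y -> `|phi y| <= M.
Proof.
move=> bN oU NU C1.
have cphi : {within closure N, continuous phi}.
  apply: continuous_in_subspaceT => y; rewrite inE => /NU Uy.
  exact: C1_on_continuous C1 Uy.
have [M [_ /(_ (M + 1))]] := compact_bounded (continuous_compact cphi (compact_closure_bounded bN)).
rewrite ltrDl ltr01 => /(_ isT) bM; exists (Num.max 0 (M + 1)); first by rewrite le_max lexx.
move=> y Ny; rewrite le_max; apply/orP; right; apply: bM.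
by exists y => //; exact: subset_closure.
Qed.

Lemma weighted_L1_patch N u phi M :
  measurable (N : set Leb) -> measurable_fun (N : set Leb) (phi : Leb -> R) ->
  0 <= M -> (forall y, N y -> `|phi y| <= M) -> weighted_L1 s u -> weighted_L1 s (patch u N phi).
Proof.
move=> mN mphi M0 phiM [mu iu].
have mg : measurable_fun [set: Leb] (patch u N phi : Leb -> R).
  rewrite -(setvU (N : set Leb)); apply/measurable_funU => //; first exact: measurableC.
  split.
    apply: (eq_measurable_fun (u : Leb -> R)); last exact: measurable_funTS.
    by move=> y; rewrite inE => Ny; rewrite patch_out.
  apply: (eq_measurable_fun (phi : Leb -> R)) => //.
  by move=> y; rewrite inE => Ny; rewrite patch_in.
split=> //.
apply: (integrable_dominated (g := fun y : Leb => `|u y * wgt s (y : Rn)| + M * wgt s (y : Rn))).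
- exact: (measurable_funM mg (@measurable_wgt R n s)).
- move=> y; have w0 := ltW (wgt_gt0 s (y : Rn)).
  rewrite !normrM (ger0_norm w0) -mulrDl ler_wpM2r//.
  have [Ny|Ny] := pselect (N y).
    by rewrite patch_in// (le_trans (phiM _ Ny))// lerDr.
  by rewrite patch_out// lerDl.
- apply: (integrable_add (integrable_abs iu)); apply: integrable_scale.
  exact: integrable_wgt.
Qed.

Lemma weighted_L1_add_indic g (delta : R) (x0 : Rn) (r : R) : 0 < r -> weighted_L1 s g ->
  weighted_L1 s (fun y => g y + delta * \1_[set y | `|x0 - y| < r] y).
Proof.
move=> r0 [mg ig].
have mB : measurable ([set y | `|x0 - y| < r] : set Leb).
  apply: measurable_open; rewrite (_ : [set y | _] = ball x0 r); first exact: ball_open.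
  by rewrite -ball_normE.
have mi : measurable_fun [set: Leb] (\1_[set y : Rn | `|x0 - y| < r] : Leb -> R).
  exact: measurable_indic.
have mgi : measurable_fun [set: Leb]
    (fun y : Leb => g y + delta * \1_[set y : Rn | `|x0 - y| < r] y).
  exact: (measurable_funD mg (measurable_funM (measurable_cst _) mi)).
split; first exact: mgi.
apply: (integrable_dominated (g := fun y : Leb =>
    `|g y * wgt s (y : Rn)| + `|delta| * wgt s (y : Rn))).
- exact: (measurable_funM mgi (@measurable_wgt R n s)).
- move=> y; have w0 := ltW (wgt_gt0 s (y : Rn)).
  rewrite !normrM (ger0_norm w0) -mulrDl ler_wpM2r//.
  apply: le_trans (ler_normD _ _) _; rewrite lerD2l normrM ler_piMr//.
  by rewrite indicE; case: (_ \in _); rewrite ?normr1 ?normr0.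
- apply: (integrable_add (integrable_abs ig)); apply: integrable_scale.
  exact: integrable_wgt.
Qed.

End patched.

Lemma compact_pos_min (R : realType) (n : nat) (f : 'rV[R]_n.+1 -> R) (A : set 'rV[R]_n.+1) :
  compact A -> {within A, continuous f} -> (forall y, A y -> 0 < f y) ->
  exists2 m, 0 < m & forall y, A y -> m <= f y.
Proof.
move=> cA cf f0; have [A0|A0] := pselect (A !=set0); last first.
  by exists 1 => // y Ay; exfalso; apply: A0; exists y.
have [y Ay fy] := EVT_min_rV A0 cA cf.
by rewrite inE in Ay; exists (f y) => [|z Az]; [exact: f0|apply: fy; rewrite inE].
Qed.

Lemma MVT_near (R : realType) (F : R -> R) (t0 tau eta a h : R) :
  (forall t, derivable F t 1) ->
  (forall t, `|t - t0| < tau -> `|(F^`())%classic t0 - (F^`())%classic t| <= eta) ->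
  0 <= h -> `|a - t0| < tau -> `|a + h - t0| < tau ->
  ((F^`())%classic t0 - eta) * h <= F (a + h) - F a /\
  `|F (a + h) - F a| <= (`|(F^`())%classic t0| + eta) * h.
Proof.
move=> dF F'near h0 at0 aht0.
have [xi xiP ->] : exists2 c, c \in `[a, a + h] & F (a + h) - F a = (F^`())%classic c * (a + h - a).
  apply: MVT_segment; first by rewrite lerDl.
    by move=> t _; rewrite derive1E; exact/derivableP.
  by apply: derivable_within_continuous => t _; exact: dF.
have -> : a + h - a = h by rewrite addrC addKr.
have xit : `|xi - t0| < tau.
  move: xiP at0 aht0; rewrite in_itv/= !ltr_norml => /andP[? ?] /andP[? ?] /andP[? ?].
  by apply/andP; split; lra.
have := F'near xi xit; set F0 := (F^`())%classic t0; set F1 := (F^`())%classic xi => F01.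
split.
  by rewrite ler_wpM2r// lerBlDr addrC -lerBlDr; exact: le_trans (ler_norm _) F01.
rewrite normrM (ger0_norm h0) ler_wpM2r//.
by rewrite -[F1](subrK F0) addrC (le_trans (ler_normD _ _))// lerD2l distrC.
Qed.

Theorem theorem4p6 (R : realType) (n : nat) (c s : R)
    (Omega : set 'rV[R]_n.+1) (F : R -> R) (u : 'rV[R]_n.+1 -> R)
    (c_gt0 : 0 < c) (s_gt0 : 0 < s) (s_lt1 : s < 1)
    (Omega_nonempty : Omega !=set0) (Omega_open : open Omega)
    (Omega_connected : connected Omega) (Omega_bounded : bounded_set Omega)
    (F_derivable : forall t, derivable F t 1)
    (F'_continuous : continuous (F^`())%classic)
    (u_continuous : {within Omega, continuous u})
    (u_minimizer : minimizer_by_above c s F Omega u) :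
  viscosity_supersolution c s F Omega u.
Proof.
have [[mu _ _] Efin _] := u_minimizer.
have [Ifin Pfin] := energy_fin_num c_gt0 Efin.
have uw : weighted_L1 s u.
  by apply: weighted_L1_of_interaction Omega_open Omega_nonempty mu _ => //; rewrite ltey_eq Ifin.
split; [exact: u_continuous|exact: L1_s_of_weighted_L1|].
move=> x0 N phi Ox0 nN NO mN [U [oU NU C2]] phix0 phi_lt.
have [C1 _] := C2.
have Nx0 : N x0 by exact: nbhs_singleton.
have Ux0 : U x0 by apply: NU; exact: subset_closure.
have NsU : N `<=` U by apply: subset_trans NU; exact: subset_closure.
have bN : bounded_set N.
  have [M [Mr OM]] := Omega_bounded; exists M; split => // x Mx y Ny.
  exact: (OM x Mx y (NO y Ny)).
have phi_le y : N y -> phi y <= u y.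
  by move=> Ny; have [yx|yx0] := eqVneq y x0; [rewrite yx phix0|exact/ltW/phi_lt].
have cphi y : U y -> {for y, continuous phi} by exact: C1_on_continuous.
have cu y : Omega y -> {for y, continuous u}.
  by move: u_continuous; rewrite continuous_open_subspace// => h Oy; apply: h; rewrite inE.
have mphi : measurable_fun (N : set (lebesgue_space R n)) phi.
  have mU := measurable_open oU.
  exact: (measurable_funS mU NsU (measurable_continuous_in oU cphi)).
have [Mphi Mphi0 MphiP] := C1_on_bounded bN oU NU C1.
set g := patch u N phi.
have gw : weighted_L1 s g by exact: weighted_L1_patch mN mphi Mphi0 MphiP uw.
have g_in y : N y -> g y = phi y by exact: patch_in.
have g_le y : g y <= u y.
  by have [Ny|Ny] := pselect (N y); [rewrite g_in ?phi_le|rewrite /g patch_out].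
have gx0 : g x0 = u x0 by rewrite g_in.
have [r1 r10 r1N] : exists2 r1, 0 < r1 & forall y, `|y - x0| < r1 -> N y.
  have /nbhs_ballP[r/= r0 rP] := nN; exists r => // y yx0.
  by apply: rP; rewrite -ball_normE/= distrC.
have [r2 [r20 _ [C C0 sd]]] := C2_symmetric_difference oU C2 Ux0.
(* If x is within r of x0 and y within r of x, then y and 2 x - y are both in N. *)
pose r := Num.min r1 r2 / 2.
have r0 : 0 < r by rewrite divr_gt0// lt_min r10.
have rr1 : r + r <= r1 by rewrite -splitr ge_min lexx.
have rr2 : r <= r2 / 2 by rewrite ler_pM2r ?invr_gt0// ge_min lexx orbT.
have gsd x : `|x - x0| < r -> symdiff_bound C r g x.
  move=> xr y xy.
  have yN : N y.
    apply: r1N; apply: lt_le_trans rr1.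
    have -> : y - x0 = (y - x) + (x - x0) by rewrite addrA subrK.
    by apply: le_lt_trans (ler_normD _ _) _; rewrite ltrD// distrC.
  have yN' : N (x *+ 2 - y).
    apply: r1N; apply: lt_le_trans rr1.
    have -> : x *+ 2 - y - x0 = (x - y) + (x - x0).
      by rewrite mulr2n -!addrA; congr (_ + _); rewrite addrCA.
    by apply: le_lt_trans (ler_normD _ _) _; rewrite ltrD.
  have xN : N x.
    by apply: r1N; apply: lt_le_trans xr _; apply: le_trans rr1; rewrite lerDl ltW.
  by rewrite !g_in//; apply: sd; exact: lt_le_trans rr2.
have cg : {for x0, continuous g}.
  apply/continuous_normP => e e0.
  have [b b0 bP] := (continuous_normP phi x0).1 (cphi _ Ux0) e e0.
  exists (Num.min b r1); first by rewrite lt_min b0.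
  move=> y; rewrite lt_min => /andP[yb yr1].
  by rewrite !g_in//; [exact: bP|exact: r1N].
have truncE : truncated_fraclap c s g x0 = (fun eps => c * cut_fraclap s (sharp eps) g x0).
  by apply/funext => eps; rewrite /truncated_fraclap -Rintegral_outside_ball.
have cvgw := cvg_cut_fraclap_sharp s_gt0 s_lt1 C0 r0 gw gsd.
set Lg := lim (cut_fraclap s (sharp eps) g x0 @[eps --> 0^'+]) in cvgw.
have cvgc : truncated_fraclap c s g x0 eps @[eps --> 0^'+] --> c * Lg.
  by rewrite truncE; apply: cvgM; [exact: cvg_cst|exact: cvgw].
split.
  split; last by apply/cvg_ex; exists (c * Lg).
  by move=> eps eps0; exact: integrable_outside_ball.
rewrite /fraclap (cvg_lim _ cvgc)// gx0 leNgt; apply/negP => LF.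
set F0 := (F^`())%classic (u x0) in LF.
(* One eta is lost in the passage to nearby points, one in the lifting by delta, and
   one in the variation of F'. *)
pose eta := (F0 - c * Lg) / 4.
have eta0 : 0 < eta by rewrite divr_gt0// subr_gt0.
have [rho1 rho10 [eps1 eps10 usc]] :=
  cut_fraclap_sharp_usc s_gt0 s_lt1 C0 r0 gw gsd cg (divr_gt0 eta0 c_gt0).
have [tau tau0 tauP] : exists2 tau, 0 < tau & forall t, `|t - u x0| < tau ->
    `|F0 - (F^`())%classic t| <= eta.
  have /cvgrPdist_le/(_ eta eta0)/nbhs_ballP[tau/= tau0 tP] := F'_continuous (u x0).
  by exists tau => // t tt; apply: tP; rewrite -ball_normE/= distrC.
have tau3 : 0 < tau / 3 by rewrite divr_gt0.
have [r3 r30 r3P] := (continuous_normP u x0).1 (cu _ Ox0) (tau / 3) tau3.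
pose R0 := Num.min (Num.min r1 rho1) r3.
have R00 : 0 < R0 by rewrite !lt_min r10 rho10.
pose rho := R0 / 3; have rho0 : 0 < rho by rewrite divr_gt0.
have rho2 : 2 * rho < R0 by rewrite mulrA ltr_pdivrMr// mulrC ltr_pM2l// ltr_nat.
have R0r1 : R0 <= r1 by rewrite !ge_min lexx.
have R0rho1 : R0 <= rho1 by rewrite !ge_min lexx orbT.
have R0r3 : R0 <= r3 by rewrite ge_min lexx orbT.
have near_in y : `|x0 - y| <= 2 * rho -> `|y - x0| < R0.
  by rewrite distrC => yr; exact: le_lt_trans rho2.
have near_N y : `|x0 - y| <= 2 * rho -> N y.
  by move=> /near_in yr; apply: r1N; exact: lt_le_trans R0r1.
(* On this annulus u - phi has a positive minimum m, so that phi + delta <= u there. *)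
pose A := [set y | rho <= `|x0 - y| <= 2 * rho].
have [m m0 mP] : exists2 m, 0 < m & forall y, A y -> m <= u y - phi y.
  apply: compact_pos_min.
  - apply: bounded_closed_compact.
      exists (`|x0| + 2 * rho); split; first exact: num_real.
      move=> M' M'r y /andP[_ yr]; rewrite -[y](subrK x0) addrC.
      apply: le_trans (ler_normD _ _) (le_trans _ (ltW M'r)).
      by rewrite lerD2l distrC.
    have cn : continuous (fun y : 'rV[R]_n.+1 => `|x0 - y|).
      move=> y; apply/continuous_normP => e e0; exists e => // z zy.
      apply: le_trans (ler_dist_dist _ _) _.
      by rewrite opprB addrC addrA subrK ltW.
    rewrite (_ : A = (fun y => `|x0 - y|) @^-1` `[rho, 2 * rho]%classic); last first.
      by apply/seteqP; split=> y /=; rewrite /A/= in_itv.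
    by apply: closed_comp => [y _|]; [exact: cn|exact: itv_closed].
  - apply: continuous_in_subspaceT => y; rewrite inE => /andP[_ yr].
    have Ny := near_N y yr.
    exact: (continuousB (cu _ (NO _ Ny)) (cphi _ (NsU _ Ny))).
  - move=> y /andP[yr1 yr2]; rewrite subr_gt0; apply: phi_lt; first exact: near_N.
    by apply: contraTneq yr1 => ->; rewrite subrr normr0 -ltNge.
have [CT CT0 CTP] := cut_fraclap_add_indic_le s_gt0 x0 rho0 gw.
have CT10 : 0 < CT + 1 by rewrite ltr_wpDl.
have etac0 : 0 < eta / c by exact: divr_gt0.
pose delta := Num.min m (Num.min (tau / 3) (eta / c / (CT + 1))).
have delta0 : 0 < delta.
  by rewrite !lt_min m0 tau3/=; exact: divr_gt0.
have deltam : delta <= m by rewrite ge_min lexx.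
have deltat : delta <= tau / 3 by rewrite !ge_min lexx orbT.
have deltaCT : delta * CT <= eta / c.
  apply: (@le_trans _ _ (eta / c / (CT + 1) * CT)).
    by rewrite ler_wpM2r// !ge_min lexx !orbT.
  by rewrite mulrAC ler_pdivrMr// ler_wpM2l ?lerDl// ltW.
pose B := [set y | `|x0 - y| < 2 * rho].
pose Phi y := g y + delta * \1_B y.
have Pw : weighted_L1 s Phi by apply: weighted_L1_add_indic => //; rewrite mulr_gt0.
have PhiB y : B y -> Phi y = phi y + delta.
  move=> By; rewrite /Phi indicE mem_set// mulr1 g_in//.
  by apply: near_N; exact: ltW.
have Phi_out y : ~ cube x0 rho y -> Phi y <= u y.
  move=> /negP; rewrite -ltNge => yrho.
  have [yB|yB] := pselect (B y); last by rewrite /Phi indicE memNset// mulr0 addr0.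
  rewrite PhiB// -lerBrDl; apply: (le_trans deltam); apply: mP.
  by rewrite /A/= !ltW.
have Phi_le y : Phi y <= u y + delta.
  rewrite /Phi lerD// indicE.
  by case: (_ \in _); rewrite ?mulr1 ?mulr0// ltW.
have cube_B y : cube x0 rho y -> B y.
  by move=> yc; apply: le_lt_trans yc _; rewrite mulr2n mulrDl mul1r ltrDl.
have w_le y : excess u Phi y <= delta by apply: excess_le => //; exact: ltW.
have cubeO : cube x0 rho `<=` Omega.
  by move=> y /cube_B/ltW/near_N; exact: NO.
apply: (@energy_decrease R n s s_gt0 c F Omega u Phi x0 rho delta (Mphi + delta) eps1 F0 eta
  (`|F0| + eta) c_gt0 Omega_open u_minimizer _ uw Pw (ltW rho0) cubeO Phi_out (ltW delta0) Phi_le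
  _ _ eps10 _ eta0).
- apply: continuous_measurable_fun => t.
  exact: (differentiable_continuous ((derivable1_diffP _ _).1 (F_derivable t))).
- move=> y /cube_B yB; rewrite PhiB//; apply: le_trans (ler_normD _ _) _.
  by rewrite (gtr0_norm delta0) lerD2r; apply: MphiP; apply: near_N; exact: ltW.
- move=> y yc.
  have uy : `|u y - u x0| <= tau / 3.
    rewrite distrC; apply: r3P; apply: lt_le_trans R0r3; apply: near_in.
    exact/ltW/cube_B.
  have w0 := excess_ge0 u Phi y; have wd := w_le y.
  apply: (@MVT_near R F (u x0) tau eta (u y) (excess u Phi y) F_derivable tauP w0).
    by apply: le_lt_trans uy _; lra.
  rewrite addrAC; apply: le_lt_trans (ler_normD _ _) _.
  by rewrite (ger0_norm w0); lra.
- move=> eps x eps0 epse xc.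
  have xr : `|x - x0| < rho1.
    by apply: lt_le_trans R0rho1; apply: near_in; exact/ltW/cube_B.
  have h1 := CTP delta x eps (ltW delta0) xc eps0 Pw.
  have h2 := usc x eps xr eps0 epse.
  have h3 : cut_fraclap s (sharp eps) Phi x <= Lg + eta / c + eta / c.
    by apply: le_trans h1 _; exact: lerD.
  apply: le_trans (ler_wpM2l (ltW c_gt0) h3) _.
  rewrite !mulrDr [c * (eta / c)]mulrC divfK ?gt_eqF// /eta; lra.
- have iw := integrable_excess uw Pw (ltW rho0) Phi_out Phi_le (ltW delta0).
  have cphix0 := cphi _ Ux0; have cux0 := cu _ Ox0.
  have d4 : 0 < delta / 4 by rewrite divr_gt0.
  have [a a0 aP] := (continuous_normP phi x0).1 cphix0 (delta / 4) d4.
  have [b b0 bP] := (continuous_normP u x0).1 cux0 (delta / 4) d4.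
  (* On the cube of half-side q the excess is at least delta / 2. *)
  pose q := Num.min (Num.min a b) rho / 2.
  have q0 : 0 < q by rewrite divr_gt0// !lt_min a0 b0.
  have qm : q < Num.min (Num.min a b) rho.
    by rewrite /q ltr_pdivrMr// ltr_pMr ?ltr1n// !lt_min a0 b0.
  apply: (@Rintegral_gt0_cube R n _ x0 q (delta / 2) q0 _ iw).
  - by rewrite divr_gt0.
  - by move=> y; exact: excess_ge0.
  move=> y yq; have := le_lt_trans yq qm; rewrite !lt_min => /andP[/andP[ya yb] yrho].
  rewrite /excess le_max; apply/orP; right.
  have yB : B y by apply: cube_B; exact: ltW.
  rewrite PhiB//; rewrite distrC in ya; rewrite distrC in yb.
  have := aP y ya; have := bP y yb; rewrite phix0 !ler_norml.
  by move=> /andP[? ?] /andP[? ?]; lra.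
Qed.
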